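(* The closed unit ball $B_{C(K)^*}$ of $C(K)^*$ is not $w^*$-separable, while $\{\mu_n : n\in\mathbb N\}$ separates the points of $C(K)$ (that is, for every nonzero $h\in C(K)$ there is $n\in\mathbb N$ with $\int_K h\,d\mu_n\neq 0$), so $C(K)^*$ is $w^*$-separable.
   Context: Setting. $\mathfrak c$ is the cardinality of the continuum. Fix a cardinal $\kappa$ with $\omega_1\le\kappa\le\mathfrak c$. Let $\lambda$ be the usual product probability measure on the Baire $\sigma$-algebra of $2^\kappa$, and let $\mathfrak B$ be its measure algebra (Baire sets modulo $\lambda$-null sets); $\lambda$ also denotes the induced probability measure on $\mathfrak B$. Boolean operations are written $\cup,\cap,\setminus$, the order is $\subseteq$, the least and greatest elements are $\mathbf 0,\mathbf 1$; for a Boolean algebra $\mathfrak D$, $\mathfrak D^+$ is the set of its nonzero elements. Let $\mathfrak C=\mathfrak B^{\mathbb N}$ with coordinatewise operations, with elements $c=(c(n))_n$. Fix an independent family $\{N_b: b\in\mathfrak B^+\}$ of subsets of $\mathbb N$, i.e. $\bigcap_{b\in s}N_b\setminus\bigcup_{b'\in t}N_{b'}\ne\emptyset$ for all finite disjoint $s,t\subseteq\mathfrak B^+$. For $b\in\mathfrak B^+$ define $G_b\in\mathfrak C$ by $G_b(n)=b$ if $n\in N_b$ and $G_b(n)=\mathbf 0$ otherwise. Let $\mathfrak A$ be the subalgebra of $\mathfrak C$ generated by $\{G_b:b\in\mathfrak B^+\}$, and let $K$ be the Stone space of all ultrafilters on $\mathfrak A$; for $a\in\mathfrak A$ let $\widehat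 a=\{\mathcal F\in K: a\in\mathcal F\}$. Measures. For $n\in\mathbb N$, $\mu_n(c)=\lambda(c(n))$ for $c\in\mathfrak C$. A (finitely additive) probability measure $\mu$ on $\mathfrak A$ induces $\widehat a\mapsto\mu(a)$ on clopen subsets of $K$, which extends uniquely to a Radon measure on $K$, still denoted $\mu$; in this way (the restriction to $\mathfrak A$ of) each $\mu_n$ is regarded as a Radon probability measure on $K$. $C(K)$ is the Banach space of real-valued continuous functions on $K$ with the supremum norm, and $C(K)^*$ is identified with the space of Radon measures on $K$. *)

(* Defs.v *)
From HB Require Import structures.
From mathcomp Require Import all_boot all_order all_algebra generic_quotient finmap.
From mathcomp Require Import all_classical all_reals all_analysis.

Set Implicit Arguments.
Unset Strict Implicit.
Unset Printing Implicit Defensive.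

Import Order.Theory GRing.Theory Num.Theory.
Import numFieldNormedType.Exports.

Local Open Scope quotient_scope.
Local Open Scope classical_set_scope.
Local Open Scope ring_scope.

Fact measAlg_display : Order.disp_t.
Proof. exact: Order.default_display. Qed.

Section MeasureAlgebra.
Context (d : measure_display) (T : measurableType d) (R : realType).
Variable mu : {measure set T -> \bar R}.

Notation msets := (set_type (@measurable d T)).
Implicit Types A B C : msets.

Definition null_diff : rel msets :=
  fun A B => mu ((\val A `\` \val B) `|` (\val B `\` \val A)) == 0%E.

Let mval A : measurable (\val A).
Proof. exact: set_mem (valP A). Qed.

Let mdiff A B : measurable ((\val A `\` \val B) `|` (\val B `\` \val A)).
Proof. by apply: measurableU; apply: measurableD; exact: mval. Qed.

Let nullP A B : reflect
  (mu.-negligible ((\val A `\` \val B) `|` (\val B `\` \val A))) (null_diff A B).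
Proof. by apply: (iffP eqP) => /negligibleP; apply; exact: mdiff. Qed.

Fact null_diff_refl : reflexive null_diff.
Proof. by move=> A; rewrite /null_diff setDv setU0 measure0. Qed.

Fact null_diff_sym : symmetric null_diff.
Proof. by move=> A B; rewrite /null_diff setUC. Qed.

Fact null_diff_trans : transitive null_diff.
Proof.
move=> B A C /nullP AB /nullP BC; apply/nullP.
apply: negligibleS (negligibleU AB BC) => x; rewrite /setU /setD /=.
have := pselect (\val B x); tauto.
Qed.

Canonical null_diff_equiv :=
  EquivRel null_diff null_diff_refl null_diff_sym null_diff_trans.

(* Measurable sets modulo [mu]-null sets; [set_type (@measurable d T)] is the
   subtype of measurable sets. *)
Definition measAlg := {eq_quot null_diff}.

HB.instance Definition _ := EqQuotient.on measAlg.
HB.instance Definition _ := Choice.on measAlg.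

Definition mset0 : msets := exist _ set0 (mem_set measurable0).
Definition msetT : msets := exist _ setT (mem_set measurableT).
Definition msetI A B : msets :=
  exist _ (\val A `&` \val B) (mem_set (measurableI _ _ (mval A) (mval B))).
Definition msetU A B : msets :=
  exist _ (\val A `|` \val B) (mem_set (measurableU _ _ (mval A) (mval B))).
Definition msetC A : msets :=
  exist _ (~` \val A) (mem_set (measurableC (mval A))).

Implicit Types x y z : measAlg.

Definition ma_meet x y : measAlg := \pi_measAlg (msetI (repr x) (repr y)).
Definition ma_join x y : measAlg := \pi_measAlg (msetU (repr x) (repr y)).
Definition ma_compl x : measAlg := \pi_measAlg (msetC (repr x)).

Let repr_pi A : null_diff (repr (\pi_measAlg A)) A.
Proof. by apply/eqquotP; exact: (@reprK _ measAlg). Qed.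

Let msets_inj A B : \val A = \val B -> A = B. Proof. exact: val_inj. Qed.

Lemma pi_meet A B :
  ma_meet (\pi_measAlg A) (\pi_measAlg B) = \pi_measAlg (msetI A B).
Proof.
apply/eqquotP/nullP; have /nullP a := repr_pi A; have /nullP b := repr_pi B.
apply: negligibleS (negligibleU a b) => x; rewrite /setU /setD /setI /=.
have := pselect (\val A x); have := pselect (\val (repr (\pi_measAlg A)) x).
have := pselect (\val B x); have := pselect (\val (repr (\pi_measAlg B)) x).
tauto.
Qed.

Lemma pi_join A B :
  ma_join (\pi_measAlg A) (\pi_measAlg B) = \pi_measAlg (msetU A B).
Proof.
apply/eqquotP/nullP; have /nullP a := repr_pi A; have /nullP b := repr_pi B.
apply: negligibleS (negligibleU a b) => x; rewrite /setU /setD /setI /=.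
have := pselect (\val A x); have := pselect (\val (repr (\pi_measAlg A)) x).
have := pselect (\val B x); have := pselect (\val (repr (\pi_measAlg B)) x).
tauto.
Qed.

Lemma pi_compl A : ma_compl (\pi_measAlg A) = \pi_measAlg (msetC A).
Proof.
apply/eqquotP/nullP; have /nullP a := repr_pi A.
apply: negligibleS a => x /=; rewrite /setU /setD /setC /=.
have := pselect (\val A x); have := pselect (\val (repr (\pi_measAlg A)) x).
tauto.
Qed.


Definition ma_le x y := ma_meet x y == x.
Definition ma_lt x y := (y != x) && ma_le x y.

Fact ma_meetC : commutative ma_meet.
Proof.
elim/quotW => A; elim/quotW => B; rewrite (pi_meet A B) (pi_meet B A); congr (\pi_measAlg _).
by apply: msets_inj => /=; rewrite setIC.
Qed.

Fact ma_joinC : commutative ma_join.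
Proof.
elim/quotW => A; elim/quotW => B; rewrite (pi_join A B) (pi_join B A); congr (\pi_measAlg _).
by apply: msets_inj => /=; rewrite setUC.
Qed.

Fact ma_meetA : associative ma_meet.
Proof.
elim/quotW => A; elim/quotW => B; elim/quotW => C.
rewrite (pi_meet B C) (pi_meet A (msetI B C)) (pi_meet A B) (pi_meet (msetI A B)).
congr (\pi_measAlg _).
by apply: msets_inj => /=; rewrite setIA.
Qed.

Fact ma_joinA : associative ma_join.
Proof.
elim/quotW => A; elim/quotW => B; elim/quotW => C.
rewrite (pi_join B C) (pi_join A (msetU B C)) (pi_join A B) (pi_join (msetU A B)).
congr (\pi_measAlg _).
by apply: msets_inj => /=; rewrite setUA.
Qed.

Fact ma_joinKI y x : ma_meet x (ma_join x y) = x.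
Proof.
elim/quotW: x => A; elim/quotW: y => B; rewrite (pi_join A B) (pi_meet A); congr (\pi_measAlg _).
by apply: msets_inj => /=; rewrite setUC setKU.
Qed.

Fact ma_meetKU y x : ma_join x (ma_meet x y) = x.
Proof.
elim/quotW: x => A; elim/quotW: y => B; rewrite (pi_meet A B) (pi_join A); congr (\pi_measAlg _).
by apply: msets_inj => /=; rewrite setIC setKI.
Qed.

Fact ma_meetUl : left_distributive ma_meet ma_join.
Proof.
elim/quotW => A; elim/quotW => B; elim/quotW => C.
rewrite (pi_join A B) (pi_meet (msetU A B) C) (pi_meet A C) (pi_meet B C) pi_join.
congr (\pi_measAlg _).
by apply: msets_inj => /=; rewrite setIUl.
Qed.

Fact ma_meetxx : idempotent_op ma_meet.
Proof.
elim/quotW => A; rewrite pi_meet; congr (\pi_measAlg _).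
by apply: msets_inj => /=; rewrite setIid.
Qed.

HB.instance Definition _ := Order.isMeetJoinDistrLattice.Build
  measAlg_display measAlg (fun _ _ => erefl) (fun _ _ => erefl)
  ma_meetC ma_joinC ma_meetA ma_joinA ma_joinKI ma_meetKU ma_meetUl ma_meetxx.

Fact ma_le0x x : (\pi_measAlg mset0 <= x)%O.
Proof.
elim/quotW: x => A; apply/eqP; rewrite [LHS](pi_meet _ A); congr (\pi_measAlg _).
by apply: msets_inj => /=; rewrite set0I.
Qed.

Fact ma_lex1 x : (x <= \pi_measAlg msetT)%O.
Proof.
elim/quotW: x => A; apply/eqP; rewrite [LHS](pi_meet A); congr (\pi_measAlg _).
by apply: msets_inj => /=; rewrite setIT.
Qed.

HB.instance Definition _ :=
  Order.hasBottom.Build measAlg_display measAlg ma_le0x.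
HB.instance Definition _ :=
  Order.hasTop.Build measAlg_display measAlg ma_lex1.

Fact ma_joinxC x : ma_join x (ma_compl x) = \pi_measAlg msetT.
Proof.
elim/quotW: x => A; rewrite pi_compl (pi_join A); congr (\pi_measAlg _).
by apply: msets_inj => /=; rewrite setUv.
Qed.

Fact ma_meetxC x : ma_meet x (ma_compl x) = \pi_measAlg mset0.
Proof.
elim/quotW: x => A; rewrite pi_compl (pi_meet A); congr (\pi_measAlg _).
by apply: msets_inj => /=; rewrite setICr.
Qed.

HB.instance Definition _ := Order.TBDistrLattice_hasComplement.Build
  measAlg_display measAlg ma_joinxC ma_meetxC.

Definition ma_measure x : \bar R := mu (\val (repr x)).

Lemma ma_measure_pi A : ma_measure (\pi_measAlg A) = mu (\val A).
Proof.
suff le A1 A2 : null_diff A1 A2 -> (mu (\val A1) <= mu (\val A2))%E.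
  apply/eqP; rewrite eq_le; apply/andP; split; apply: le => //.
  by rewrite null_diff_sym.
move=> /eqP A12; rewrite -[leRHS]adde0 -A12.
apply: le_trans (measureU2 mu (mval A2) (mdiff A1 A2)).
apply: le_measure; rewrite ?inE; [exact: mval| |].
  by apply: measurableU; [exact: mval|exact: mdiff].
move=> x A1x; have [A2x|A2x] := pselect (\val A2 x); [by left|].
by right; left.
Qed.

End MeasureAlgebra.

Lemma measAlg_neq (d : measure_display) (T : measurableType d) (R : realType)
  (P : probability T R) : (\bot%O : measAlg P) != \top%O.
Proof.
apply/negP => /eqP/eqquotP/eqP /=; rewrite set0D set0U setD0.
by rewrite [LHS]probability_setT => /eqP; rewrite onee_eq0.
Qed.

Section FunBooleanAlgebra.
Context (I : Type) (d : Order.disp_t) (D : ctbDistrLatticeType d).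
Implicit Types f g h : I -> D.
Local Open Scope order_scope.

Fact fun_meetUl :
  left_distributive (@Order.meet _ (I -> D)) (@Order.join _ (I -> D)).
Proof. by move=> f g h; apply/funext => i; exact: meetUl. Qed.

HB.instance Definition _ := Order.Lattice_Meet_isDistrLattice.Build
  FunOrder.fun_display (I -> D) fun_meetUl.

Fact fun_le0x f : (fun=> \bot : D) <= f.
Proof. by apply/lefP => i; exact: le0x. Qed.

Fact fun_lex1 f : f <= (fun=> \top : D).
Proof. by apply/lefP => i; exact: lex1. Qed.

HB.instance Definition _ :=
  Order.hasBottom.Build FunOrder.fun_display (I -> D) fun_le0x.
HB.instance Definition _ :=
  Order.hasTop.Build FunOrder.fun_display (I -> D) fun_lex1.

Definition fun_compl f : I -> D := fun i => ~` f i.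

Fact fun_joinxC f : f `|` fun_compl f = \top.
Proof. by apply/funext => i; exact: joinxC. Qed.

Fact fun_meetxC f : f `&` fun_compl f = \bot.
Proof. by apply/funext => i; exact: meetxC. Qed.

HB.instance Definition _ := Order.TBDistrLattice_hasComplement.Build
  FunOrder.fun_display (I -> D) fun_joinxC fun_meetxC.

End FunBooleanAlgebra.

Section Stone.
Context (d : Order.disp_t) (C : ctbDistrLatticeType d).
Implicit Types (A F : set C).

Definition subalgebra A := [/\ A \bot%O, A \top%O,
  forall a, A a -> A (~` a)%O,
  forall a b, A a -> A b -> A (a `&` b)%O &
  forall a b, A a -> A b -> A (a `|` b)%O].

Definition generated_subalgebra (S : set C) : set C := smallest subalgebra S.

Definition ba_filter A F := [/\ F `<=` A, F \top%O, ~ F \bot%O,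
  forall a b, F a -> F b -> F (a `&` b)%O &
  forall a b, F a -> A b -> (a <= b)%O -> F b].

(* Ultrafilters are the maximal proper filters of the subalgebra [A]. *)
Definition ba_ultrafilter A F :=
  ba_filter A F /\ forall F', ba_filter A F' -> F `<=` F' -> F' = F.

Lemma ba_ultrafilter_ex A : A \top%O -> (\bot%O : C) != \top%O ->
  exists F, ba_ultrafilter A F.
Proof.
move=> A1 C01; pose X := {F : set C | ba_filter A F}.
pose r (F G : X) := `[< sval F `<=` sval G >].
have X0 : ba_filter A [set \top%O].
  split=> [_ -> //|//|/eqP|a b -> ->|a b -> _]; first exact/negP.
    by rewrite /= meetxx.
  by rewrite le1x => /eqP.
have [|||Ch tot|F Fmax] := @Zorn X r.
- by move=> F; apply/asboolP.
- by move=> F G H /asboolP FG /asboolP GH; apply/asboolP; exact: subset_trans GH.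
- move=> F G /asboolP FG /asboolP GF; apply: eq_sig_hprop => [? ? ?|]; first exact: Prop_irrelevance.
  by apply/seteqP; split.
- have [[F0 ChF0]|Che] := pselect (exists F0 : X, Ch F0); last first.
    by exists (exist _ _ X0) => F1 ChF; case: Che; exists F1.
  have fU : ba_filter A (\bigcup_(F in Ch) sval F).
    split.
    + by move=> a [F _]; case: (svalP F) => + _ _ _ _; apply.
    + by exists F0 => //; case: (svalP F0).
    + by case=> F _; case: (svalP F).
    + move=> a b [F ChF Fa] [G ChG Gb].
      have [/asboolP FG|/asboolP GF] := tot _ _ ChF ChG.
        by exists G => //; case: (svalP G) => _ _ _ + _; apply => //; exact: FG.
      by exists F => //; case: (svalP F) => _ _ _ + _; apply => //; exact: GF.
    + move=> a b [F ChF Fa] Ab ab; exists F => //.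
      by case: (svalP F) => _ _ _ _; apply; first exact: Fa.
  exists (exist _ _ fU) => F ChF; apply/asboolP => a Fa; by exists F.
- exists (sval F); split; first exact: svalP.
  move=> F' fF' FF'; have := Fmax (exist _ F' fF').
  by move=> /(_ (asboolT FF'))/(congr1 sval).
Qed.

Definition stone A := {F : set C | ba_ultrafilter A F}.

HB.instance Definition _ A := gen_eqMixin (stone A).
HB.instance Definition _ A := gen_choiceMixin (stone A).

Definition hat A (a : C) : set (stone A) := [set F | sval F a].

Definition stone_base A : set (set (stone A)) := [set @hat A a | a in A].

Fact stone_base_cover A : \bigcup_(U in @stone_base A) id U = setT.
Proof.
apply/seteqP; split => // F _; have [[FA F1 _ _ _] _] := svalP F.
by exists (hat \top%O) => //; exists \top%O => //; exact: FA.
Qed.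

Fact stone_base_join A (U V : set (stone A)) (F : stone A) :
  stone_base U -> stone_base V -> U F -> V F ->
  exists W, [/\ stone_base W, W F & W `<=` U `&` V].
Proof.
move=> [a Aa <-] [b Ab <-] Fa Fb; have [[FA _ _ FI _] _] := svalP F.
exists (hat (a `&` b)%O); split; [|exact: FI|].
  by exists (a `&` b)%O => //; apply: FA; exact: FI.
move=> G Gab; have [[_ _ _ _ GU] _] := svalP G.
by split; apply: GU Gab _ _ => //; [exact: leIl|exact: leIr].
Qed.

HB.instance Definition _ A := isBaseTopological.Build (stone A)
  (@stone_base_cover A) (@stone_base_join A).

End Stone.

(* The Baire sigma-algebra is the one generated by the zero sets, i.e. the least
   one for which all the continuous real-valued functions are measurable. *)
Definition zero_sets (R : realType) (T : topologicalType) : set (set T) :=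
  [set f @^-1` [set 0] | f in [set f : T -> R | continuous f]].

Definition baire (R : realType) (T : ptopologicalType) :=
  g_sigma_algebraType (@zero_sets R T).

Definition borel (T : ptopologicalType) := g_sigma_algebraType (@open T).

HB.instance Definition _ (R : realType) (T : ptopologicalType) :=
  Measurable.on (baire R T).
HB.instance Definition _ (T : ptopologicalType) := Measurable.on (borel T).

(* Inner regularity with respect to compact sets. It is only used on Hausdorff
   spaces, where compact sets are closed, hence Borel. *)
Definition radon (R : realType) (T : ptopologicalType)
    (mu : probability (borel T) R) :=
  forall B : set (borel T), measurable B ->
  mu B = ereal_sup [set mu C | C in [set C : set T | compact C /\ C `<=` B]].

Section ContinuousFunctions.
Context (T : topologicalType) (R : realType).

Definition continuous_pred : {pred T -> R^o} := [pred f | `[< continuous f >]].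

Fact continuous_pred_submod : submod_closed continuous_pred.
Proof.
split=> [|k f g]; first by apply/asboolP => x; exact: cvg_cst.
move=> /asboolP cf /asboolP cg; apply/asboolP => x.
by apply: cvgD (cg x); exact: cvgZr (cf x).
Qed.

HB.instance Definition _ :=
  GRing.isSubmodClosed.Build R (T -> R^o) continuous_pred continuous_pred_submod.

Record cfun := CFun { cfun_val :> T -> R^o; _ : cfun_val \in continuous_pred }.

HB.instance Definition _ := [isSub for cfun_val].
HB.instance Definition _ := [Choice of cfun by <:].
HB.instance Definition _ := [SubChoice_isSubLmodule of cfun by <:].

(* [sup] is 0 on unbounded sets, so [sup_norm] is the supremum norm only for
   compact [T]; the set in [dual_norm] is bounded by the field of [cdual]. *)
Definition sup_norm (h : cfun) : R := sup [set `|h x| | x in setT].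

Record cdual := CDual { cdual_val :> {scalar cfun};
  _ : exists M : R, forall h, `|cdual_val h| <= M * sup_norm h }.

HB.instance Definition _ := gen_eqMixin cdual.
HB.instance Definition _ := gen_choiceMixin cdual.

Definition dual_norm (phi : cdual) : R :=
  sup [set `|phi h| | h in [set h | sup_norm h <= 1]].

Definition dual_ball : set cdual := [set phi | dual_norm phi <= 1].

(* [cdual] carries the weak* topology: pointwise convergence on [cfun]. *)
HB.instance Definition _ := Topological.copy cdual
  (initial_topology (fun phi : cdual => (phi : cfun -> R) : {ptws cfun -> R})).

End ContinuousFunctions.
Arguments dual_ball : clear implicits.

Definition separable_set (X : topologicalType) (S : set X) :=
  exists D : set X, [/\ countable D, D `<=` S & S `<=` closure D].

Definition cube (I : Type) := {ptws I -> bool}.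

HB.instance Definition _ (I : Type) := Topological.on (cube I).
HB.instance Definition _ (I : Type) := Pointed.copy (cube I) (I -> bool).

(* The product of the uniform probabilities on [bool] is characterised by its
   values on the cylinders. *)
Definition coin_tossing (I : choiceType) (R : realType)
    (P : probability (baire R (cube I)) R) :=
  forall (J : {fset I}) (e : I -> bool),
  P [set x : cube I | {in J, x =1 e}] = (2^-1 ^+ #|` J|)%:E.

Section Construction.
Context (d : measure_display) (T : measurableType d) (R : realType).
Variable (P : probability T R).
Variable N : measAlg P -> set nat.

(* Only the values of [N] at nonzero elements are relevant. *)
Definition independent_family :=
  forall s t : {fset measAlg P}, [disjoint s & t]%fset ->
  \bot%O \notin s -> \bot%O \notin t ->
  (\bigcap_(b in [set` s]) N b) `\` (\bigcup_(b in [set` t]) N b) !=set0.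

Definition gen (b : measAlg P) : nat -> measAlg P :=
  fun n => if n \in N b then b else \bot%O.

Definition algA : set (nat -> measAlg P) :=
  generated_subalgebra [set gen b | b in [set b | b != \bot%O]].

Definition stoneK := stone algA.

HB.instance Definition _ := 
  Topological.copy stoneK (stone algA).

Fact stoneK_inhabited : exists F : stoneK, True.
Proof.
have [||F FU] := @ba_ultrafilter_ex _ _ algA; last by exists (exist _ F FU).
- by move=> A [[]].
- apply/eqP => /(congr1 (fun f => f 0%N)); apply/eqP; exact: measAlg_neq.
Qed.

HB.instance Definition _ := isPointed.Build stoneK (projT1 (cid stoneK_inhabited)).

End Construction.

(* Main.v *)
From HB Require Import structures.
Require Import Defs.
From mathcomp Require Import all_boot all_order all_algebra generic_quotient finmap.
From mathcomp Require Import all_classical all_reals all_analysis.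
From mathcomp Require Import ring lra zify.

Set Implicit Arguments.
Unset Strict Implicit.
Unset Printing Implicit Defensive.

Import Order.Theory GRing.Theory Num.Theory.
Import numFieldNormedType.Exports.

Local Open Scope classical_set_scope.
Local Open Scope ring_scope.

(**
A point of [K] is determined by the family of all [b] whose generator [gen N b]
it contains, and by independence of the sets [N b] these families are exactly
the centered families of nonzero elements of the measure algebra.

** The measures separate points

Let [L n] be a positive functional on [C(K)] giving each clopen set [hat a] the
mass [lambda (a n)] ([represents]), and suppose that all [L n h] vanish. The
points of finite families [s] are dense in [K], so it is enough that [h] vanishes
there, which is proved by induction on the cardinal of [s]
([separates_finite_points]). Choose [n] in all [N b] with [b] in [s], and outside
finitely many other [N b] on which the approximate value of [h] near the points
of the subfamilies of [s] depends. Then, up to a small error, [L n] only sees the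
values of [h] at these points, each weighted by the measure of an atom of the
algebra generated by [s]; the induction hypothesis kills all of them but
[h] at [s], and the weight of the latter is the measure of the meet of [s],
which is nonzero.

** The dual is weak*-separable

Functionals [L n] as above exist: restrict attention to a finite set [s] of
generators, send a point [x] of the probability space to the point of [K] whose
family consists of the [b] in [s] with [n] in [N b] and [x] in [b], and integrate
[h] along this map; then pass to the limit over [s] along an ultrafilter
([represents_ex]). A sequence of functionals that separates points has
weak*-dense rational span, by elementary linear algebra
([separating_separable]).

** The unit ball is not weak*-separable

Let [phi] range over a countable weak*-dense subset [D] of the ball. Since point
evaluations lie in the ball, every nonzero [b] satisfies
[phi (hat_indic (gen N b)) > 15/16] for some [phi] in [D]. For an element [m] of
the measure algebra let [local_norm phi m] be the norm of the restriction of
[phi] to the functions supported by the points containing some [a] with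
[a n <= m] for all [n]. It is superadditive and at most 1, so an exhaustion
argument gives, for every constant [C], an element [z] of measure at most [2 / C]
off which [local_norm phi m <= C * lambda m + 1/2]
([local_norm_absolutely_continuous]). With constants [C] growing along [D], the
complement [E] of the union of these [z] has measure at least [1/2].

Now consider the traces on [E] of the sets [x al = 1]. If [n] of them satisfied
[phi (hat_indic (gen N _)) > 15/16] for one [phi], then summing the indicators
shows that [local_norm phi m >= 3/4], where [m] is the set of the [x] in [E]
having more than [3n/4] of the chosen coordinates equal to 1
([large_overlap_local_norm]). By Chebyshev's inequality [m] has measure at most
[4/n], so [n <= 16 C]: each [phi] in [D] handles only finitely many coordinates,
and [D] only countably many. As [kappa] is uncountable, two coordinates are left
over. Their traces on [E] must be null, so [E] is almost contained in the set
where both coordinates vanish, of measure [1/4]: a contradiction.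
*)

(** * Ultrafilters of a subalgebra and its Stone space *)

Section StoneTheory.
Context (d : Order.disp_t) (C : ctbDistrLatticeType d).
Implicit Types (A F : set C) (a b : C).

Lemma generated_subalgebraP (S : set C) : subalgebra (generated_subalgebra S).
Proof.
split=> [B [[]] //|B [[]] //|a Ba B BS|a b Ba Bb B BS|a b Ba Bb B BS];
  have [[b0 b1 bC bI bU] _] := BS.
- by apply: bC; exact: Ba.
- by apply: bI; [exact: Ba|exact: Bb].
- by apply: bU; [exact: Ba|exact: Bb].
Qed.

Lemma sub_generated_subalgebra (S : set C) : S `<=` generated_subalgebra S.
Proof. by move=> a Sa B [_]; apply. Qed.

Lemma generated_subalgebra_ind (S Q : set C) : subalgebra Q -> S `<=` Q ->
  generated_subalgebra S `<=` Q.
Proof. by move=> sQ SQ a; apply. Qed.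

(** If neither [a] nor its complement belonged to a maximal filter, the filter
    generated by it and [a] would be proper and strictly larger. *)
Lemma ultrafilter_mem_or_compl A F a : subalgebra A -> ba_ultrafilter A F ->
  A a -> F a \/ F (~` a)%O.
Proof.
move=> [A0 A1 AC AI AU] [[FA F1 F0 FI FU] Fmax] Aa.
have [Fa|nFa] := pselect (F (~` a)%O); [by right|left].
pose F' := [set b | A b /\ exists2 f, F f & (f `&` a <= b)%O].
suff <- : F' = F by split=> //; exists \top%O => //; exact: leIr.
apply: Fmax; last by move=> b Fb; split; [exact: FA|exists b => //; exact: leIl].
split.
- by move=> b [].
- by split => //; exists \top%O => //; exact: lex1.
- move=> [_ [f Ff]]; rewrite lex0 => /eqP fa0; apply: nFa.
  apply: FU Ff _ _; first exact: AC.
  by rewrite -disj_leC fa0.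
- move=> b c [Ab [f Ff fb]] [Ac [g Fg gc]]; split; first exact: AI.
  exists (f `&` g)%O; first exact: FI.
  by rewrite lexI (le_trans _ fb) ?leI2 ?leIl//= (le_trans _ gc)// leI2// leIr.
- move=> b c [Ab [f Ff fb]] Ac bc; split => //.
  by exists f => //; exact: le_trans bc.
Qed.

Lemma mem_or_compl_ultrafilter A F : ba_filter A F ->
  (forall a, A a -> F a \/ F (~` a)%O) -> ba_ultrafilter A F.
Proof.
move=> fF dF; split => // F' [F'A _ F'0 F'I _] FF'; apply/seteqP; split => // a F'a.
have [//|Fca] := dF _ (F'A _ F'a).
by case: F'0; rewrite -(meetxC a); apply: F'I => //; exact: FF'.
Qed.

Variable A : set C.
Hypothesis sA : subalgebra A.
Implicit Types K : stone A.

Lemma stone_sub K : sval K `<=` A. Proof. by case: K => F [[]]. Qed.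

Lemma stone1 K : sval K \top%O. Proof. by case: K => F [[]]. Qed.

Lemma stone0 K : ~ sval K \bot%O. Proof. by case: K => F [[]]. Qed.

Lemma stone_le K a b : sval K a -> A b -> (a <= b)%O -> sval K b.
Proof. by case: K => F [[_ _ _ _ +] _] /=; apply. Qed.

Lemma stoneI K a b : A a -> A b -> sval K (a `&` b)%O <-> sval K a /\ sval K b.
Proof.
move=> Aa Ab; split; last by case: K => F [[_ _ _ + _] _] /= => h [? ?]; exact: h.
by move=> Kab; split; apply: stone_le Kab _ _ => //; [exact: leIl|exact: leIr].
Qed.

Lemma stoneC K a : A a -> sval K (~` a)%O <-> ~ sval K a.
Proof.
move=> Aa; split; last first.
  by case: (ultrafilter_mem_or_compl sA (svalP K) Aa) => // Ka /(_ Ka).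
case: K => F [[_ _ F0 FI _] _] /= Fca Fa.
by apply: F0; rewrite -(meetxC a); exact: FI.
Qed.

Lemma stoneU K a b : A a -> A b -> sval K (a `|` b)%O <-> sval K a \/ sval K b.
Proof.
have [_ _ AC AI AU] := sA.
move=> Aa Ab; rewrite -[(a `|` b)%O]complK complU.
rewrite (stoneC _ (AI _ _ (AC _ Aa) (AC _ Ab))).
rewrite (stoneI _ (AC _ Aa) (AC _ Ab)) !stoneC//.
by have := pselect (sval K a); have := pselect (sval K b); tauto.
Qed.

Lemma hat_open a : open (@hat _ _ A a).
Proof.
have [Aa|nAa] := pselect (A a).
  rewrite openE => K Ka; exists (hat a) => //; split => //.
  by exists [set (@hat _ _ A a)] => [U ->|]; [exists a|rewrite bigcup_set1].
rewrite (_ : hat a = set0); first exact: open0.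
by apply/seteqP; split => // K /= /stone_sub.
Qed.

Lemma hat_closed a : closed (@hat _ _ A a).
Proof.
have [Aa|nAa] := pselect (A a).
  rewrite -openC (_ : ~` _ = hat (~` a)%O); first exact: hat_open.
  apply/seteqP; split => K; first by move=> nKa; apply/(stoneC K Aa).
  by move/(stoneC K Aa).
rewrite (_ : hat a = set0); first exact: closed0.
by apply/seteqP; split => // K /= /stone_sub.
Qed.

Lemma stone_nbhs K (U : set (stone A)) : nbhs K U ->
  exists2 a, sval K a & hat a `<=` U.
Proof.
move=> [B [[D DB <-] [V DV VK]] BU].
have [a Aa aV] := DB _ DV; exists a; first by move: VK; rewrite -aV.
by move=> L La; apply: BU; exists V => //=; rewrite -aV.
Qed.

(** An ultrafilter on the space converges to the ultrafilter of those [a] for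
    which it contains [hat a]. *)
Lemma stone_compact : compact [set: stone A].
Proof.
have [A0 A1 AC AI AU] := sA.
rewrite compact_ultra => U UU _.
pose F := [set a | A a /\ U (@hat _ _ A a)].
have fF : ba_filter A F.
  split.
  - by move=> a [].
  - split => //; apply: filterS filterT => K _; exact: stone1.
  - move=> [_ /filter_ex[K]]; exact: stone0.
  - move=> a b [Aa Ua] [Ab Ub]; split; first exact: AI.
    by apply: filterS (filterI Ua Ub) => K [Ka Kb]; apply/stoneI.
  - move=> a b [Aa Ua] Ab ab; split => //; apply: filterS Ua => K Ka.
    exact: stone_le Ka Ab ab.
have uF : ba_ultrafilter A F.
  apply: mem_or_compl_ultrafilter => // a Aa.
  have [Ua|Ua] := in_ultra_setVsetC (hat a) UU; [by left|right].
  by split; [exact: AC|apply: filterS Ua => K nKa; apply/(stoneC K Aa)].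
exists (exist _ F uF); split => // V /stone_nbhs[a [Aa Ua]] aV.
exact: filterS aV Ua.
Qed.

End StoneTheory.

(** * Continuous functions and the weak* topology *)

Section ContinuousFunctionSpace.
Context (T : topologicalType) (R : realType).
Implicit Types (f g h : cfun T R) (phi psi : cdual T R).

Lemma cfun_continuous h : continuous (h : T -> R).
Proof. by case: h => h /= /asboolP. Qed.

Definition mk_cfun (f : T -> R) (cf : continuous f) : cfun T R :=
  @CFun T R f (asboolT cf).

Lemma cfunP f g : f =1 g -> f = g.
Proof. by move=> fg; apply/val_inj/funext. Qed.

Lemma cfunD f g x : (f + g) x = f x + g x.
Proof. by []. Qed.

Lemma cfun0 x : (0 : cfun T R) x = 0.
Proof. by []. Qed.

Lemma cfunB f g x : (f - g) x = f x - g x.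
Proof. by []. Qed.

Lemma cfunZ (c : R) f x : (c *: f) x = c * f x.
Proof. by []. Qed.

Lemma cfun_sum (I : Type) (s : seq I) (p : pred I) (F : I -> cfun T R) x :
  (\sum_(i <- s | p i) F i) x = \sum_(i <- s | p i) F i x.
Proof. by elim/big_rec2 : _ => // i y f _ <-. Qed.

Hypothesis T0 : [set: T] !=set0.
Hypothesis cT : compact [set: T].

(** Compactness enters here: it makes the supremum defining [sup_norm] finite, and
    thus point evaluations bounded functionals. *)
Lemma cfun_le_sup_norm h x : `|h x| <= sup_norm h.
Proof.
have cim : compact (h @` [set: T]).
  by apply: continuous_compact => //; apply/continuous_subspaceT/cfun_continuous.
have [M [_ hM]] := compact_bounded cim.
apply: ub_le_sup; last by exists x.
exists (M + 1) => _ [y _ <-]; apply: (hM (M + 1)); first by rewrite ltrDl.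
by exists y.
Qed.

Lemma sup_norm_le h (M : R) : (forall x, `|h x| <= M) -> sup_norm h <= M.
Proof.
move=> hM; apply: ge_sup; last by move=> _ [x _ <-].
by have [x _] := T0; exists `|h x|; exists x.
Qed.

Lemma sup_norm_ge0 h : 0 <= sup_norm h.
Proof. by have [x _] := T0; apply: le_trans (cfun_le_sup_norm h x). Qed.

Lemma cdualD phi f g : phi (f + g) = phi f + phi g. Proof. exact: linearD. Qed.
Lemma cdualZ phi (c : R) f : phi (c *: f) = c * phi f. Proof. exact: linearZ. Qed.

Lemma dual_ball_le phi h : dual_ball T R phi -> (forall x, `|h x| <= 1) ->
  `|phi h| <= 1.
Proof.
rewrite /dual_ball /= => phi1 h1; apply: le_trans phi1.
have [M phiM] : exists M, forall h, `|phi h| <= M * sup_norm h by case: (phi).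
apply: ub_le_sup; last by exists h => //=; exact: sup_norm_le.
exists `|M| => _ [g /= g1 <-]; apply: le_trans (phiM g) _.
apply: (@le_trans _ _ (`|M| * sup_norm g)).
  by apply: ler_wpM2r; [exact: sup_norm_ge0|exact: ler_norm].
by rewrite ler_piMr.
Qed.

Lemma mk_cdual (L : cfun T R -> R) (M : R) :
  (forall c f g, L (c *: f + g) = c * L f + L g) ->
  (forall h, `|L h| <= M * sup_norm h) ->
  exists phi : cdual T R, (phi : cfun T R -> R) = L.
Proof.
move=> Llin Lb.
pose Ll : {scalar cfun T R} :=
  HB.pack_for {scalar cfun T R} L (@GRing.isLinear.Build R (cfun T R) R _ L Llin).
by exists (@CDual T R Ll (ex_intro _ M Lb)).
Qed.

Lemma dual_ballP phi : (forall h, `|phi h| <= sup_norm h) -> dual_ball T R phi.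
Proof.
move=> phi1; apply: ge_sup; last by move=> _ [h /= h1 <-]; exact: le_trans h1.
exists `|phi 0|; exists 0 => //=.
by apply: sup_norm_le => x; rewrite cfun0 normr0.
Qed.

Lemma cdual_cvg (F : set_system (cdual T R)) phi : Filter F ->
  (forall h, (fun psi : cdual T R => psi h) @ F --> phi h) -> F --> phi.
Proof.
move=> FF Fphi U [B [[V oV <-] Vphi] BU]; apply: filterS BU _.
have : (fun psi : cdual T R => (psi : {ptws cfun T R -> R})) @ F -->
    ((phi : cfun T R -> R) : {ptws cfun T R -> R}).
  apply/cvg_sup => h W [Y [[Z oZ <-] Zphi] YW].
  apply: filterS YW _; apply: (Fphi h); exact: open_nbhs_nbhs.
by apply; exact: open_nbhs_nbhs.
Qed.

Lemma nbhs_cdual phi U : nbhs phi U -> exists (hs : seq (cfun T R)) (e : R),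
  0 < e /\ forall psi, (forall h, h \in hs -> `|psi h - phi h| < e) -> U psi.
Proof.
pose G := [set U : set (cdual T R) | exists (hs : seq (cfun T R)) (e : R),
  0 < e /\ forall psi, (forall h, h \in hs -> `|psi h - phi h| < e) -> U psi].
have FG : Filter G.
  split.
  - by exists [::], 1.
  - move=> X Y [hs [e [e0 hX]]] [gs [r [r0 hY]]].
    exists (hs ++ gs), (Num.min e r); split; first by rewrite lt_min e0.
    move=> psi psie; split.
      apply: hX => h hh; have := psie h; rewrite mem_cat hh lt_min => /(_ isT).
      by case/andP.
    apply: hY => h hh; have := psie h; rewrite mem_cat hh lt_min orbT => /(_ isT).
    by case/andP.
  - move=> X Y XY [hs [e [e0 hX]]]; exists hs, e; split => // psi /hX; exact: XY.
suff : nbhs phi `<=` G by apply.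
apply: (@cdual_cvg G phi) => h W /nbhs_ballP[e /= e0 eW]; exists [:: h], e; split => // psi.
move=> /(_ h (mem_head _ _)) psie; apply: eW.
by rewrite /ball /= distrC.
Qed.

Lemma cdual_eval_continuous h : continuous (fun psi : cdual T R => psi h).
Proof.
move=> phi; pose e (psi : cdual T R) : {ptws cfun T R -> R} := psi : cfun T R -> R.
have ce : continuous e by exact: initial_continuous.
apply: (@continuous_comp _ _ _ e (fun f : {ptws cfun T R -> R} => f h) phi).
  exact: ce.
exact: (@proj_continuous (cfun T R) (fun=> R) h).
Qed.

Lemma closure_cdual_gt (D : set (cdual T R)) phi h (r : R) :
  closure D phi -> r < phi h -> exists2 psi, D psi & r < psi h.
Proof.
move=> /(_ [set psi : cdual T R | r < psi h]) Dphi rphi.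
have U : nbhs phi [set psi : cdual T R | r < psi h].
  exact: (@cdual_eval_continuous h phi [set y | r < y] (lt_nbhsr rphi)).
by have [psi [Dpsi rpsi]] := Dphi U; exists psi.
Qed.

End ContinuousFunctionSpace.

(** * A separating sequence makes the dual weak*-separable *)

Section CountableSeparation.
Context (T : topologicalType) (R : realType).
Variable L : nat -> cdual T R.
Hypothesis L_sep : forall h : cfun T R, (forall n, L n h = 0) -> h = 0.

Let M (hs : seq (cfun T R)) n : 'M[R]_(n, size hs) :=
  \matrix_(i, j) L i (hs`_j).

(** The rows [(L i h)_h] span a space whose dimension is at most the number of
    test functions, so finitely many of them span everything. A linear form that
    vanishes on these rows is a combination of test functions killed by all the
    [L i], hence zero, hence killed by [phi]: the row of [phi] is in the span. *)
Lemma separating_interpolation (phi : cdual T R) (hs : seq (cfun T R)) :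
  exists n (c : 'I_n -> R),
    forall h, h \in hs -> phi h = \sum_(i < n) c i * L i h.
Proof.
have rk_ex : exists r, `[< exists n, \rank (M hs n) = r >].
  by exists (\rank (M hs 0)); apply/asboolP; exists 0%N.
have rk_ub r : `[< exists n, \rank (M hs n) = r >] ->
    (r <= size hs)%N.
  by move=> /asboolP[n <-]; exact: rank_leq_col.
case: (ex_maxnP rk_ex rk_ub) => r /asboolP[n rn] rmax.
exists n.
have sub k : (row 0 (\row_j L k (hs`_j) : 'M[R]_(1, size hs)) <= M hs n)%MS.
  pose p := (maxn n k.+1).
  have np : (n <= p)%N by rewrite leq_maxl.
  have kp : (k < p)%N by rewrite leq_maxr.
  have Mnp : (M hs n <= M hs p)%MS.
    apply/row_subP => i.
    rewrite (_ : row i _ = row (widen_ord np i) (M hs p)) ?row_sub//.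
    by apply/rowP => j; rewrite !mxE.
  have -> : row 0 (\row_j L k (hs`_j)) = row (Ordinal kp) (M hs p).
    by apply/rowP => j; rewrite !mxE.
  apply: submx_trans (row_sub _ _) _.
  suff : (M hs n == M hs p)%MS by case/andP.
  rewrite -(geq_leqif (mxrank_leqif_eq Mnp)) rn; apply: rmax.
  by apply/asboolP; exists p.
pose v : 'rV[R]_(size hs) := \row_j phi (hs`_j).
have vM : (v <= M hs n)%MS.
  rewrite submxE; apply/eqP/rowP => j; rewrite !mxE.
  pose g : cfun T R := \sum_(i < size hs) cokermx (M hs n) i j *: hs`_i.
  have gE (psi : cdual T R) : psi g = \sum_(i < size hs) psi (hs`_i) * cokermx (M hs n) i j.
    by rewrite linear_sum; apply: eq_bigr => i _; rewrite cdualZ mulrC.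
  transitivity (phi g); first by rewrite gE; apply: eq_bigr => i _; rewrite !mxE.
  suff -> : g = 0 by rewrite linear0.
  apply: L_sep => k; rewrite gE.
  have := sub k; rewrite submxE => /eqP/rowP/(_ j); rewrite !mxE => E; rewrite -[RHS]E.
  by apply: eq_bigr => i _; rewrite !mxE.
have /submxP[D vD] := vM.
exists (fun i => D 0 i) => h hin.
have hi : (index h hs < size hs)%N by rewrite index_mem.
have := congr1 (fun w : 'rV_(size hs) => w 0 (Ordinal hi)) vD.
rewrite !mxE /= nth_index// => ->.
by apply: eq_bigr => i _; rewrite mxE /= nth_index.
Qed.

Let comb_ex (q : seq rat) : exists phi : cdual T R,
  (phi : cfun T R -> R) = fun h => \sum_(i < size q) ratr q`_i * L i h.
Proof.
have [B LB] : {B : nat -> R & forall n h, `|L n h| <= B n * sup_norm h}.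
  apply: (@choice _ _ (fun n b => forall h, `|L n h| <= b * sup_norm h)).
  by move=> n; case: (L n).
apply: (@mk_cdual _ _ _ (\sum_(i < size q) `|ratr q`_i| * B i)).
  move=> c f g; rewrite mulr_sumr -big_split; apply: eq_bigr => i _ /=.
  by rewrite cdualD cdualZ; ring.
move=> h; apply: le_trans (ler_norm_sum _ _ _) _.
rewrite mulr_suml; apply: ler_sum => i _; rewrite normrM -mulrA.
exact: ler_wpM2l.
Qed.

(** A basic weak* neighbourhood only constrains finitely many test functions, on
    which a functional is a real combination of the family; rational coefficients
    approximate the real ones. *)
Lemma separating_separable : separable_set [set: cdual T R].
Proof.
have [c cE] := choice comb_ex.
exists (range c); split => //.
  exact: sub_countable (card_image_le _ _) (countableP _).
move=> phi _ U /nbhs_cdual[hs [e [e0 eU]]].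
have [n [a phiE]] := separating_interpolation phi hs.
pose B := \sum_(h <- hs) \sum_(i < n) `|L i h|.
have B0 : 0 <= B by apply: sumr_ge0 => h _; apply: sumr_ge0.
have hB h : h \in hs -> \sum_(i < n) `|L i h| <= B.
  move=> hin; rewrite /B (big_rem h hin) /= lerDl.
  by apply: sumr_ge0 => g _; apply: sumr_ge0.
pose eta := e / (B + 1).
have eta0 : 0 < eta by rewrite divr_gt0// ltr_wpDl.
have [q qa] : {q : 'I_n -> rat & forall i, `|ratr (q i) - a i| < eta}.
  apply: (@choice _ _ (fun i r => `|ratr r - a i| < eta)) => i.
  have [r] : exists r, ratr r \in `](a i - eta), (a i + eta)[.
    by apply: rat_in_itvoo; lra.
  rewrite in_itv /= => /andP[r1 r2]; exists r.
  by rewrite ltr_norml; apply/andP; split; lra.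
pose s := [seq q i | i <- enum 'I_n].
have ss : size s = n by rewrite size_map size_enum_ord.
exists (c s); split; first by exists s.
apply: eU => h hin; rewrite cE phiE//.
have -> : \sum_(i < size s) ratr s`_i * L i h = \sum_(i < n) ratr (q i) * L i h.
  rewrite ss; apply: eq_bigr => i _; congr (ratr _ * _).
  by rewrite (nth_map i) ?size_enum_ord// nth_ord_enum.
rewrite -sumrB; apply: le_lt_trans (ler_norm_sum _ _ _) _.
apply: (@le_lt_trans _ _ (eta * B)).
  apply: le_trans (ler_wpM2l (ltW eta0) (hB _ hin)).
  rewrite mulr_sumr; apply: ler_sum => i _.
  by rewrite -mulrBl normrM ler_wpM2r// ltW.
by rewrite /eta mulrAC ltr_pdivrMr ?ltr_wpDl// mulrDr mulr1 ltrDl.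
Qed.

End CountableSeparation.

(** * The algebra and the points of its Stone space *)

Lemma clopen_indic_continuous (T : topologicalType) (R : realType) (U : set T) :
  open U -> closed U -> continuous (\1_U : T -> R).
Proof.
move=> oU cU x; have [Ux|nUx] := pselect (U x).
  apply: (@near_cst_continuous _ _ (1 : R)); near=> y.
  rewrite indicE mem_set//; near: y; exact: open_nbhs_nbhs.
apply: (@near_cst_continuous _ _ (0 : R)); near=> y.
rewrite indicE memNset//; near: y; apply: open_nbhs_nbhs; split => //.
exact: closed_openC.
Unshelve. all: by end_near. Qed.

Section PointsOfK.
Context (d : measure_display) (T : measurableType d) (R : realType).
Variables (P : probability T R) (N : measAlg P -> set nat).
Notation B := (measAlg P).
Notation K := (stoneK N).
Notation A := (algA N).
Implicit Types (b m : B) (s t : {fset B}) (F : K) (a : nat -> B).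

Lemma algA_subalgebra : subalgebra A.
Proof. exact: generated_subalgebraP. Qed.

Lemma algA_gen b : b != \bot%O -> A (gen N b).
Proof. by move=> b0; apply: sub_generated_subalgebra; exists b. Qed.

Lemma algA_meet (r : seq B) : \bot%O \notin r -> A (\meet_(b <- r) gen N b)%O.
Proof.
have [_ A1 _ AI _] := algA_subalgebra.
elim: r => [_|b r IH]; first by rewrite big_nil.
rewrite in_cons negb_or eq_sym big_cons => /andP[b0 /IH Ar].
by apply: AI => //; exact: algA_gen.
Qed.

Lemma algA_join (r : seq B) : \bot%O \notin r -> A (\join_(b <- r) gen N b)%O.
Proof.
have [A0 _ _ _ AU] := algA_subalgebra.
elim: r => [_|b r IH]; first by rewrite big_nil.
rewrite in_cons negb_or eq_sym big_cons => /andP[b0 /IH Ar].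
by apply: AU => //; exact: algA_gen.
Qed.

Lemma mem_meet_gen (r : seq B) F : \bot%O \notin r ->
  sval F (\meet_(b <- r) gen N b)%O <-> forall b, b \in r -> sval F (gen N b).
Proof.
have sA := algA_subalgebra.
elim: r => [_|b r IH]; first by rewrite big_nil; split => // _; exact: stone1.
rewrite in_cons negb_or eq_sym big_cons => /andP[b0 r0].
rewrite (stoneI F (algA_gen b0) (algA_meet r0)) IH//; split.
  by move=> [Fb Fr] x; rewrite in_cons => /orP[/eqP->//|/Fr].
by move=> h; split => [|x xr]; apply: h; rewrite in_cons ?eqxx// xr orbT.
Qed.

Lemma mem_join_gen (r : seq B) F : \bot%O \notin r ->
  sval F (\join_(b <- r) gen N b)%O <-> exists2 b, b \in r & sval F (gen N b).
Proof.
have sA := algA_subalgebra.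
elim: r => [_|b r IH].
  by rewrite big_nil; split => [/stone0//|[b]]; rewrite in_nil.
rewrite in_cons negb_or eq_sym big_cons => /andP[b0 r0].
rewrite (stoneU sA F (algA_gen b0) (algA_join r0)) IH//; split.
  move=> [Fb|[x xr Fx]]; first by exists b; rewrite ?mem_head.
  by exists x => //; rewrite in_cons xr orbT.
move=> [x]; rewrite in_cons => /orP[/eqP->|xr] Fx; first by left.
by right; exists x.
Qed.

Lemma meet_gen_le (r : seq B) n :
  ((\meet_(b <- r) gen N b)%O n <= \meet_(b <- r) b)%O.
Proof.
elim: r => [|b r IH]; first by rewrite !big_nil lex1.
rewrite !big_cons; apply: leI2 => //; rewrite /gen.
by case: ifP => // _; exact: le0x.
Qed.

Lemma meet_gen_eq (r : seq B) n : (forall b, b \in r -> N b n) ->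
  (\meet_(b <- r) gen N b)%O n = (\meet_(b <- r) b)%O.
Proof.
elim: r => [|b r IH] Nr; first by rewrite !big_nil.
rewrite !big_cons /= [LHS](_ : _ = (gen N b n `&` (\meet_(b <- r) gen N b)%O n)%O)//.
rewrite IH; last by move=> x xr; apply: Nr; rewrite in_cons xr orbT.
by rewrite /gen mem_set//; apply: Nr; exact: mem_head.
Qed.

Lemma join_gen_eq0 (r : seq B) n : (forall b, b \in r -> ~ N b n) ->
  (\join_(b <- r) gen N b)%O n = \bot%O.
Proof.
elim: r => [|b r IH] Nr; first by rewrite big_nil.
rewrite big_cons /= [LHS](_ : _ = (gen N b n `|` (\join_(b <- r) gen N b)%O n)%O)//.
rewrite IH; last by move=> x xr; apply: Nr; rewrite in_cons xr orbT.
by rewrite joinx0 /gen memNset//; apply: Nr; exact: mem_head.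
Qed.

(** The meet of the generators lies in the ultrafilter [F], hence is not zero, and
    it is pointwise below the meet of the elements. *)
Lemma meet_mem_neq0 (r : seq B) F : \bot%O \notin r ->
  (forall b, b \in r -> sval F (gen N b)) -> (\meet_(b <- r) b)%O != \bot%O.
Proof.
move=> r0 /(mem_meet_gen F r0) Fr; apply/eqP => m0; apply: (@stone0 _ _ _ F).
suff <- : (\meet_(b <- r) gen N b)%O = \bot%O by [].
by apply/funext => n; apply/eqP; rewrite -lex0 -[leRHS]m0; exact: meet_gen_le.
Qed.

(** Membership of [a] in an ultrafilter depends on finitely many generators only:
    this property passes to complements, meets and joins. *)
Lemma algA_finite_support a : A a -> exists2 s : {fset B}, \bot%O \notin s &
  forall F F', (forall b, b \in s -> sval F (gen N b) <-> sval F' (gen N b)) ->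
  sval F a <-> sval F' a.
Proof.
move=> Aa; pose Q := [set a | A a /\ exists2 s : {fset B}, \bot%O \notin s &
  forall F F', (forall b, b \in s -> sval F (gen N b) <-> sval F' (gen N b)) ->
  sval F a <-> sval F' a].
suff : Q a by case.
have sA := algA_subalgebra; have [A0 A1 AC AI AU] := sA.
have sub2 s t (F F' : K) :
    (forall b, b \in (s `|` t)%fset -> sval F (gen N b) <-> sval F' (gen N b)) ->
    (forall b, b \in s -> sval F (gen N b) <-> sval F' (gen N b)) /\
    (forall b, b \in t -> sval F (gen N b) <-> sval F' (gen N b)).
  by move=> st; split => b bs; apply: st; rewrite in_fsetU bs ?orbT.
apply: (generated_subalgebra_ind _ _ Aa); last first.
  move=> _ [b b0 <-]; split; first exact: algA_gen.
  exists [fset b]%fset; first by rewrite in_fset1 eq_sym.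
  by move=> F F'; apply; rewrite in_fset1.
split.
- split => //; exists fset0 => // F F' _; split => /stone0//.
- split => //; exists fset0 => // F F' _; split => _; exact: stone1.
- move=> x [Ax [s s0 sP]]; split; first exact: AC.
  by exists s => // F F' FF'; rewrite !stoneC// (sP F F').
- move=> x y [Ax [s s0 sP]] [Ay [t t0 tP]]; split; first exact: AI.
  exists (s `|` t)%fset; first by rewrite in_fsetU negb_or s0.
  by move=> F F' /sub2[FF's FF't]; rewrite !stoneI// (sP F F')// (tP F F').
- move=> x y [Ax [s s0 sP]] [Ay [t t0 tP]]; split; first exact: AU.
  exists (s `|` t)%fset; first by rewrite in_fsetU negb_or s0.
  by move=> F F' /sub2[FF's FF't]; rewrite !stoneU// (sP F F')// (tP F F').
Qed.

(** The points of [K] correspond to the centered families of nonzero elements;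
    this one is the point of the finite family [s]. *)
Definition is_point s F :=
  forall b, b != \bot%O -> sval F (gen N b) <-> b \in s.

Hypothesis N_indep : independent_family N.

(** The ultrafilter consists of the [a] such that [a n] contains the meet of [s]
    for all [n] in the [N b], [b] in [s], and outside finitely many other [N b].
    It is proper by independence; it decides every generator, hence every element
    of the algebra. *)
Lemma is_point_ex s : \bot%O \notin s -> (\meet_(b <- s) b)%O != \bot%O ->
  exists F, is_point s F.
Proof.
move=> s0 m0; set m := (\meet_(b <- s) b)%O in m0.
have sA := algA_subalgebra; have [A0 A1 AC AI AU] := sA.
pose good t := (\bot%O : B) \notin t /\ [disjoint s & t]%fset.
pose E t := [set n | (forall b, b \in s -> N b n) /\
                     (forall b, b \in t -> ~ N b n)].
have E_ex t : good t -> exists n, E t n.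
  move=> [t0 st]; have [n [nN nt]] := N_indep st s0 t0; exists n; split.
    by move=> b bs; exact: nN.
  by move=> b bt Nbn; apply: nt; exists b.
have goodU t t' : good t -> good t' -> good (t `|` t')%fset.
  move=> [t0 st] [t'0 st']; split; first by rewrite in_fsetU negb_or t0.
  by rewrite fdisjointXU st.
have EU t t' : E (t `|` t')%fset `<=` E t `&` E t'.
  move=> n [nN nt]; split; split => // b bt; apply: nt;
    by rewrite in_fsetU bt ?orbT.
have good0 : good fset0 by split => //; exact: fdisjointX0.
pose F := [set a | A a /\ exists2 t, good t & forall n, E t n -> (m <= a n)%O].
have fF : ba_filter A F.
  split.
  - by move=> a [].
  - by split => //; exists fset0 => // n _; exact: lex1.
  - move=> [_ [t /E_ex[n En] /(_ n En)]].
    by rewrite lex0 (negbTE m0).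
  - move=> a b [Aa [t gt ta]] [Ab [t' gt' tb]]; split; first exact: AI.
    exists (t `|` t')%fset; first exact: goodU.
    by move=> n /EU[En E'n]; rewrite lexI ta// tb.
  - move=> a b [Aa [t gt ta]] Ab /lefP ab; split => //; exists t => // n /ta.
    by move/le_trans; apply; exact: ab.
have Fgen b : b != \bot%O -> b \in s -> F (gen N b).
  move=> b0 bs; split; first exact: algA_gen.
  exists fset0 => // n [/(_ _ bs) Nbn _].
  by rewrite /gen mem_set//; exact: (@meets_inf_seq _ _ _ _ predT id).
have Fgenc b : b != \bot%O -> b \notin s -> F (~` gen N b)%O.
  move=> b0 bs; split; first by apply: AC; exact: algA_gen.
  exists [fset b]%fset.
    by split; rewrite ?fdisjointX1// in_fset1 eq_sym.
  move=> n [_ /(_ b)]; rewrite in_fset1 eqxx => /(_ isT) nN.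
  rewrite [leRHS](_ : _ = ~` (gen N b n))%O// /gen memNset//.
  by rewrite compl0 lex1.
have decF a : A a -> F a \/ F (~` a)%O.
  move=> Aa; pose Q := [set a | A a /\ (F a \/ F (~` a)%O)].
  suff : Q a by case.
  have [_ F1 _ FI FU] := fF.
  apply: (generated_subalgebra_ind _ _ Aa); last first.
    move=> _ [b b0 <-]; split; first exact: algA_gen.
    by have [bs|bs] := boolP (b \in s); [left; exact: Fgen|right; exact: Fgenc].
  split.
  - split => //; right; rewrite compl0; exact: F1.
  - split => //; left; exact: F1.
  - move=> x [Ax Fx]; split; first exact: AC.
    by rewrite complK; tauto.
  - move=> x y [Ax Fx] [Ay Fy]; split; first exact: AI.
    case: Fx => [Fx|Fx]; last first.
      right; apply: FU Fx _ _; first by apply: AC; exact: AI.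
      by rewrite complI leUl.
    case: Fy => [Fy|Fy]; last first.
      right; apply: FU Fy _ _; first by apply: AC; exact: AI.
      by rewrite complI leUr.
    by left; exact: FI.
  - move=> x y [Ax Fx] [Ay Fy]; split; first exact: AU.
    case: Fx => [Fx|Fx].
      by left; apply: FU Fx _ _; [exact: AU|exact: leUl].
    case: Fy => [Fy|Fy].
      by left; apply: FU Fy _ _; [exact: AU|exact: leUr].
    by right; rewrite complU; exact: FI.
pose pt : K := exist _ F (mem_or_compl_ultrafilter fF decF).
exists pt => b b0.
split => [Fb|]; last exact: Fgen.
apply: contrapT => /negP bs.
exact: (stoneC sA pt (algA_gen b0)).1 (Fgenc b b0 bs) Fb.
Qed.

End PointsOfK.

(** * Elements of the measure algebra and their measures *)

Section MeasureAlgebraValues.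
Context (d : measure_display) (T : measurableType d) (R : realType).
Variable (P : probability T R).
Implicit Types x : measAlg P.

Definition ma_prob x : R := fine (ma_measure x).

Lemma msets_measurable (X : set_type (@measurable d T)) : measurable (\val X).
Proof. exact: set_mem (valP X). Qed.

Lemma ma_probE x : (ma_prob x)%:E = ma_measure x.
Proof. by rewrite fineK// fin_num_measure//; exact: msets_measurable. Qed.

Lemma ma_prob_ge0 x : 0 <= ma_prob x.
Proof. exact: fine_ge0. Qed.

Lemma ma_prob0 : ma_prob \bot%O = 0.
Proof. by rewrite /ma_prob ma_measure_pi measure0. Qed.

Lemma ma_prob1 : ma_prob \top%O = 1.
Proof. have E : @ma_measure _ _ _ P \top%O = P setT by exact: ma_measure_pi.
by rewrite /ma_prob E probability_setT. Qed.

Lemma ma_prob_gt0 x : x != \bot%O -> 0 < ma_prob x.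
Proof.
rewrite lt_def ma_prob_ge0 andbT; apply: contra => x0.
have {}x0 : ma_measure x = 0%E by rewrite -ma_probE (eqP x0).
rewrite -[x]reprK; apply/eqP/eqquotP/eqP => /=.
by rewrite setD0 set0D setU0.
Qed.

End MeasureAlgebraValues.

Section MeasureAlgebraMeets.
Context (d : measure_display) (T : measurableType d) (R : realType).
Variable P : {measure set T -> \bar R}.
Notation msets := (set_type (@measurable d T)).

Definition ma_class (X : msets) : measAlg P := \pi_(measAlg P)%qT X.

Definition mk_mset (X : set T) (mX : measurable X) : msets :=
  exist _ X (mem_set mX).

Lemma ma_class_meet (I : eqType) (r : seq I) (F : I -> msets) :
  exists2 X : msets, \val X = [set x | forall i, i \in r -> \val (F i) x] &
  (\meet_(i <- r) ma_class (F i))%O = ma_class X.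
Proof.
elim: r => [|i r [X XE IH]].
  exists (msetT T); last by rewrite big_nil.
  by apply/seteqP; split => x.
exists (msetI (F i) X); last first.
  by rewrite big_cons IH; exact: pi_meet.
rewrite /= XE; apply/seteqP; split => x /=.
  by move=> [Fx h] j; rewrite in_cons => /orP[/eqP->//|/h].
move=> h; split; first by apply: h; exact: mem_head.
by move=> j jr; apply: h; rewrite in_cons jr orbT.
Qed.

Lemma ma_class_eq0 (X : msets) : ma_class X = \bot%O -> P (\val X) = 0%E.
Proof.
by move=> X0; rewrite -(ma_measure_pi P X) -/(ma_class X) X0 ma_measure_pi measure0.
Qed.

Lemma ma_class_eq (X Y : msets) :
  P.-negligible ((\val X `\` \val Y) `|` (\val Y `\` \val X)) ->
  ma_class X = ma_class Y.
Proof.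
move=> XY; apply/eqquotP/eqP; apply/negligibleP => //.
by apply: measurableU; apply: measurableD; exact: msets_measurable.
Qed.

End MeasureAlgebraMeets.

(** * Functionals representing the measures separate points *)

Section Separation.
Context (d : measure_display) (T : measurableType d) (R : realType).
Variables (P : probability T R) (N : measAlg P -> set nat).
Notation B := (measAlg P).
Notation K := (stoneK N).
Notation A := (algA N).
Implicit Types (b m : B) (s t : {fset B}) (F : K) (a : nat -> B)
  (f g h : cfun K R).

Lemma stoneK_compact : compact [set: K].
Proof. exact: stone_compact (algA_subalgebra N). Qed.

Lemma stoneK_nonempty : [set: K] !=set0.
Proof. by exists point. Qed.

Definition hat_indic a : cfun K R := mk_cfun
  (@clopen_indic_continuous K R _ (@hat_open _ _ A a)
     (@hat_closed _ _ A (algA_subalgebra N) a)).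

Lemma hat_indicE a F : hat_indic a F = (`[< sval F a >])%:R.
Proof.
by rewrite /= indicE.
Qed.

Lemma stoneK_ext F F' :
  (forall b, b != \bot%O -> sval F (gen N b) <-> sval F' (gen N b)) -> F = F'.
Proof.
move=> FF'; apply: eq_sig_hprop => [? ? ?|]; first exact: Prop_irrelevance.
apply/seteqP; split => a Fa.
  have [s s0 sP] := algA_finite_support (stone_sub Fa).
  by apply/(sP F F') => // b bs; apply: FF'; apply: contraNneq s0 => <-.
have [s s0 sP] := algA_finite_support (stone_sub Fa).
by apply/(sP F F') => // b bs; apply: FF'; apply: contraNneq s0 => <-.
Qed.

Lemma cfun_ball (h : cfun K R) F (e : R) : 0 < e -> exists2 a, sval F a &
  forall F', sval F' a -> `|h F' - h F| < e.
Proof.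
move=> e0.
have /stone_nbhs[a Fa aU] : nbhs (F : stone A) [set F' : K | `|h F' - h F| < e].
  have /cvgrPdist_lt/(_ e e0) := @cfun_continuous _ _ h F.
  by apply: filterS => F'; rewrite distrC.
by exists a.
Qed.

(** What the argument for separation uses of the measures: both the integrals
    against given measures and the functionals constructed below have it. *)
Definition represents (L : nat -> cfun K R -> R) := forall n,
  [/\ forall c f g, L n (c *: f + g) = c * L n f + L n g,
      forall f : cfun K R, (forall F, 0 <= f F) -> 0 <= L n f &
      forall a, A a -> L n (hat_indic a) = ma_prob (a n)].

Section Theory.
Variable L : nat -> cfun K R -> R.
Hypothesis LP : represents L.

Lemma represents0 n : L n 0 = 0.
Proof.
have [Llin _ _] := LP n; have := Llin 1 0 0.
by rewrite scaler0 addr0 mul1r => /eqP; rewrite -subr_eq0 opprD addrA subrr sub0r oppr_eq0 => /eqP.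
Qed.

Lemma representsZ n c f : L n (c *: f) = c * L n f.
Proof. by have [Llin _ _] := LP n; rewrite -[_ *: _]addr0 Llin represents0 addr0. Qed.

Lemma representsD n f g : L n (f + g) = L n f + L n g.
Proof. by have [Llin _ _] := LP n; rewrite -[f in LHS]scale1r Llin mul1r. Qed.

Lemma represents_le n f g : (forall F, `|f F| <= g F) -> `|L n f| <= L n g.
Proof.
move=> fg; have [_ L0 _] := LP n.
have NE : L n (- f) = - L n f by rewrite -scaleN1r representsZ mulN1r.
rewrite ler_norml; apply/andP; split.
  rewrite -subr_ge0 opprK -representsD; apply: L0 => F.
  rewrite cfunD; have := fg F; rewrite ler_norml => /andP[]; lra.
rewrite -subr_ge0 -NE -representsD; apply: L0 => F.
have := fg F; rewrite ler_norml => /andP[_]; rewrite cfunB; lra.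
Qed.

End Theory.

Hypothesis N_indep : independent_family N.

(** By induction, [h] vanishes at the points of the proper subfamilies of [s]. For
    [n] in the [N b], [b] in [s], and outside the finitely many other generators
    [z] that control the oscillation of [h] near all these points, [h] is within
    [e] of [h F0] times the indicator of the meet [u] of the generators of [s],
    except on a set that [L n] does not charge. *)
Lemma separates_finite_points (L : nat -> cfun K R -> R) (h : cfun K R) :
  represents L -> (forall n, L n h = 0) ->
  forall s F, \bot%O \notin s -> is_point s F -> h F = 0.
Proof.
move=> LP Lh0 s; have [k] := ubnP #|` s|; elim: k s => // k IH s.
rewrite ltnS => sk F0 s0 F0s; set c := h F0.
have sA := algA_subalgebra N.
have m0 : (\meet_(b <- s) b)%O != \bot%O.
  apply: (meet_mem_neq0 (F := F0) s0) => b bs.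
  by apply/(F0s b) => //; apply: contraNneq s0 => <-.
apply/eqP; rewrite -normr_eq0; apply/eqP/le_anti; rewrite normr_ge0 andbT.
rewrite -(pmulr_lle0 _ (ma_prob_gt0 m0)).
apply/ler_addgt0Pl => e e0; rewrite addr0.
(* near the point of [r], up to [e], [h] depends on the generators in [t] *)
have loc (r : {fset B}) : exists t, forall F' F, is_point r F' ->
    (forall b, b \in t -> b != \bot%O -> sval F (gen N b) <-> b \in r) ->
    `|h F - h F'| < e.
  have [[F' F'r]|nr] := pselect (exists F', is_point r F'); last first.
    by exists fset0 => F' F F'r; case: nr; exists F'.
  have [a F'a aF'] := cfun_ball h F' e0.
  have [t t0 tP] := algA_finite_support (stone_sub F'a).
  exists t => F'' F F''r rt; have -> : F'' = F'.
    by apply: stoneK_ext => b b0; rewrite F''r// F'r.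
  apply: aF'; apply/(tP F F') => // b bt.
  have b0 : b != \bot%O by apply: contraNneq t0 => <-.
  by rewrite rt// F'r.
have [t tP] := choice loc.
(* the generators controlling all subfamilies of [s] at once *)
pose z := ((\bigcup_(r <- fpowerset s) t r) `\` s `\ \bot%O)%fset.
have z0 : \bot%O \notin z by rewrite !inE eqxx.
have sz : [disjoint s & z]%fset.
  by apply/fdisjointP => b bs; rewrite !inE bs /= andbF.
have [n [nN nz]] := N_indep sz s0 z0.
have nzN b : b \in z -> ~ N b n by move=> bz Nb; apply: nz; exists b.
pose u := (\meet_(b <- s) gen N b)%O; pose v := (\join_(b <- z) gen N b)%O.
have Au : A u by exact: algA_meet.
have Av : A v by exact: algA_join.
have [Llin _ LA] := LP n.
pose M := `|c| + sup_norm h.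
have : `|L n ((- c) *: hat_indic u + h)| <=
       L n (M *: hat_indic v + e *: hat_indic \top%O).
  apply: (represents_le LP) => F.
  rewrite !cfunD !cfunZ !hat_indicE.
  rewrite (asboolT (stone1 F)) mulr1.
  (* the join [v] of the generators in [z] is null for [L n]: a crude bound *)
  have [Fv|nFv] := pselect (sval F v).
    rewrite (asboolT Fv) mulr1; apply: (@le_trans _ _ M); last by rewrite lerDl ltW.
    apply: le_trans (ler_normD _ _) _; rewrite /M; apply: lerD.
      rewrite normrM normrN ler_piMr//.
      by case: asboolP => _; rewrite /= ?normr1 ?normr0.
    exact: (cfun_le_sup_norm stoneK_compact).
  rewrite (asboolF nFv) mulr0 add0r.
  pose r := [fset b in s | `[< sval F (gen N b) >]]%fset.
  have rs : (r `<=` s)%fset by apply/fsubsetP => b; rewrite !inE => /andP[].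
  have r0 : \bot%O \notin r.
    by apply: contra s0 => /(fsubsetP rs).
  have rF b : b \in r -> sval F (gen N b) by rewrite !inE => /andP[_ /asboolP].
  have [G Gr] := is_point_ex N_indep r0 (meet_mem_neq0 r0 rF).
  have hFG : `|h F - h G| < e.
    apply: (tP r G F Gr) => b bt b0; rewrite !inE.
    have [bs|nbs] /= := boolP (b \in s); first by split => /asboolP.
    split => // Fb; case: nFv; apply/(mem_join_gen F z0); exists b => //.
    rewrite !inE b0 nbs /=; apply/bigfcupP; exists r => //.
    by rewrite andbT fpowersetE.
  have [rs_eq|rs_neq] := eqVneq r s.
    have -> : c = h G.
      rewrite /c; congr (h _); apply: stoneK_ext => b b0.
      by rewrite F0s// Gr// rs_eq.
    have Fu : sval F u by apply/(mem_meet_gen F s0) => b; rewrite -rs_eq; exact: rF.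
    by rewrite (asboolT Fu) mulr1 addrC ltW.
  have nFu : ~ sval F u.
    move=> /(mem_meet_gen F s0) Fs; move/eqP: rs_neq; apply; apply/eqP.
    rewrite eqEfsubset rs; apply/fsubsetP => b bs; rewrite !inE bs /=.
    by apply/asboolP; exact: Fs.
  rewrite (asboolF nFu) mulr0 add0r; move: hFG.
  rewrite (IH r _ G r0 Gr) ?subr0 => [/ltW//|].
  by apply: leq_trans sk; apply: fproper_ltn_card; rewrite fproperEneq rs_neq.
rewrite Llin Lh0 addr0 (representsD LP) !(representsZ LP) !LA//; last first.
  by have [] := sA.
rewrite ma_prob1 mulr1 [u n](meet_gen_eq (r := s))//.
rewrite [v n](join_gen_eq0 (r := z))// ma_prob0 mulr0 add0r normrM normrN.
by rewrite (ger0_norm (ma_prob_ge0 _)).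
Qed.

(** The points of finite families are dense: [F] is approximated by the point of
    the trace of its family on a finite set of generators. *)
Lemma represents_separates (L : nat -> cfun K R -> R) (h : cfun K R) :
  represents L -> (forall n, L n h = 0) -> h = 0.
Proof.
move=> LP Lh0; apply: cfunP => F; rewrite cfun0.
apply/eqP; rewrite -normr_le0; apply/ler_addgt0Pl => e e0; rewrite addr0.
have [a Fa aF] := cfun_ball h F e0.
have [s s0 sP] := algA_finite_support (stone_sub Fa).
pose r := [fset b in s | `[< sval F (gen N b) >]]%fset.
have rs : (r `<=` s)%fset by apply/fsubsetP => b; rewrite !inE => /andP[].
have r0 : \bot%O \notin r by apply: contra s0 => /(fsubsetP rs).
have rF b : b \in r -> sval F (gen N b) by rewrite !inE => /andP[_ /asboolP].
have [G Gr] := is_point_ex N_indep r0 (meet_mem_neq0 r0 rF).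
have /aF : sval G a.
  apply/(sP F G) => // b bs; have b0 : b != \bot%O by apply: contraNneq s0 => <-.
  by rewrite Gr// !inE bs /=; split => /asboolP.
by rewrite (separates_finite_points LP Lh0 r0 Gr) sub0r normrN => /ltW.
Qed.

End Separation.

(** * Integration along a map into [K] *)

Section IntegralFunctionals.
Context (d : measure_display) (T : measurableType d) (R : realType).
Variables (P : probability T R) (N : measAlg P -> set nat).
Notation K := (stoneK N).
Notation A := (algA N).
Implicit Types (f g h : cfun K R) (a : nat -> measAlg P).

(* used with the identity of [K] and with maps from the space of [P] *)
Section Pushforward.
Context (d' : measure_display) (X : measurableType d') (Q : probability X R).
Variable theta : X -> K.
Hypothesis mtheta : forall h, measurable_fun setT (fun x => h (theta x)).

Lemma pushforward_integrable h :
  Q.-integrable setT (EFin \o (fun x => h (theta x))).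
Proof.
apply: measurable_bounded_integrable => //.
  by rewrite -ge0_fin_numE// fin_num_measure.
exists (sup_norm h); split; first exact: num_real.
move=> M hM x _; apply: le_trans (ltW hM).
exact: (cfun_le_sup_norm (stoneK_compact (N := N))).
Qed.

Lemma pushforward_linear c f g :
  \int[Q]_x (c *: f + g) (theta x) =
  c * \int[Q]_x f (theta x) + \int[Q]_x g (theta x).
Proof.
rewrite -RintegralZl//; last exact: pushforward_integrable.
rewrite -RintegralD//; last exact: pushforward_integrable.
exact: (pushforward_integrable (c *: f)).
Qed.

Lemma pushforward_le h : `|\int[Q]_x h (theta x)| <= sup_norm h.
Proof.
apply: le_trans (le_normr_Rintegral _ _) _ => //.
  exact: pushforward_integrable.
have -> : sup_norm h = \int[Q]_(x in setT) sup_norm h.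
  have Q1 : fine (Q setT) = 1 by rewrite probability_setT.
  by rewrite Rintegral_cst// Q1 mulr1.
apply: le_Rintegral => //.
- by have := integrable_norm (pushforward_integrable h).
- exact: finite_measure_integrable_cst.
- by move=> x _; exact: (cfun_le_sup_norm (stoneK_compact (N := N))).
Qed.

Lemma measurable_hat_preimage a : measurable [set x | sval (theta x) a].
Proof.
rewrite (_ : [set x | _] = (fun x => hat_indic N a (theta x)) @^-1` [set 1]).
  by rewrite -[X in measurable X]setTI; exact: mtheta.
apply/seteqP; split => x; rewrite /preimage /mkset hat_indicE.
  by move=> Ka; rewrite asboolT.
by case: asboolP => // _ /eqP; rewrite eq_sym oner_eq0.
Qed.

Lemma pushforward_hat_indic a :
  \int[Q]_x hat_indic N a (theta x) = fine (Q [set x | sval (theta x) a]).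
Proof.
rewrite /Rintegral; congr fine.
rewrite -[in RHS](setIT [set x | _]) -integral_indic//.
exact: measurable_hat_preimage.
Qed.

End Pushforward.

Lemma borel_cfun_measurable h :
  measurable_fun [set: borel K] (h : borel K -> R).
Proof.
apply: (measurability _ (measurable_realfun.RGenOpens.measurableE R)) => _ [_ [a [b ->] <-]].
rewrite setTI; apply: sub_sigma_algebra.
by move/continuousP : (@cfun_continuous _ _ h); apply; exact: interval_open.
Qed.

Lemma integrals_represent (mu : nat -> probability (borel K) R) :
  (forall n a, algA N a -> mu n (hat a) = ma_measure (a n)) ->
  represents (fun n (h : cfun K R) => \int[mu n]_x h x).
Proof.
move=> muE n; have mid := borel_cfun_measurable.
split.
- exact: (pushforward_linear (mu n) mid).
- by move=> f f0; apply: Rintegral_ge0 => x _.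
- move=> a Aa; rewrite (pushforward_hat_indic (mu n) mid).
  by rewrite /ma_prob -muE.
Qed.

End IntegralFunctionals.

(** * Existence of representing functionals *)

Lemma ultra_fmap (T U : Type) (f : T -> U) (F : set_system T) :
  UltraFilter F -> UltraFilter (f @ F).
Proof.
move=> FU; split; first exact: fmap_proper_filter.
move=> G GP FG; apply/seteqP; split => // Y GY.
have [//|FnY] := in_ultra_setVsetC (f @^-1` Y) FU.
have : G (Y `&` ~` Y) by apply: filterI => //; exact: FG.
by move=> /filter_ex[y []].
Qed.

Lemma ultra_bounded_cvg (R : realType) (T : Type) (F : set_system T)
    (f : T -> R) (M : R) : UltraFilter F ->
  (forall x, `|f x| <= M) -> cvg (f @ F).
Proof.
move=> FU fM; have := @segment_compact R (- M) M.
rewrite compact_ultra => /(_ (f @ F) (ultra_fmap f FU)) [|l [_ fl]].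
  apply: (@filterS _ F _ setT); last exact: filterT.
  by move=> x _; rewrite /= in_itv /= -ler_norml.
by apply/cvg_ex; exists l.
Qed.

Section Existence.
Context (d : measure_display) (T : measurableType d) (R : realType).
Variables (P : probability T R) (N : measAlg P -> set nat).
Hypothesis N_indep : independent_family N.
Notation B := (measAlg P).
Notation K := (stoneK N).
Notation A := (algA N).
Implicit Types (b m : B) (s t r : {fset B}) (F : K) (a : nat -> B) (n : nat)
  (h : cfun K R).

Let pt_ex r : exists F, \bot%O \notin r ->
  (\meet_(b <- r) b)%O != \bot%O -> is_point r F.
Proof.
have [r0|r0] := boolP (\bot%O \notin r); last by exists point.
have [m0|m0] := boolP ((\meet_(b <- r) b)%O != \bot%O); last by exists point.
by have [F Fr] := is_point_ex N_indep r0 m0; exists F.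
Qed.

(** The point of the family [r], with an arbitrary value for the families that
    are not the family of a point. *)
Definition finite_point r : K := projT1 (cid (pt_ex r)).

Lemma finite_pointP r : \bot%O \notin r -> (\meet_(b <- r) b)%O != \bot%O ->
  is_point r (finite_point r).
Proof. by rewrite /finite_point; case: cid. Qed.

Definition active n b : set T :=
  if `[< b != \bot%O /\ N b n >] then \val (repr b) else set0.

Lemma active_measurable n b : measurable (active n b).
Proof. by rewrite /active; case: ifP => // _; exact: msets_measurable. Qed.

(** The family that [x] would determine at the index [n] if the elements of the
    measure algebra were sets; restricting it to a finite [s] leaves only a null
    set of [x] for which it is not centered. *)
Definition trace n s x : {fset B} := [fset b in s | `[< active n b x >]]%fset.

Definition sample n s x : K := finite_point (trace n s x).

Lemma trace_neq0 n s x : \bot%O \notin trace n s x.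
Proof.
rewrite !inE negb_and; apply/orP; right; apply/asboolP.
by rewrite /active asboolF => [|[]] //; rewrite eqxx.
Qed.

Lemma measurable_trace n s (Y : set {fset B}) :
  measurable [set x | Y (trace n s x)].
Proof.
have -> : [set x | Y (trace n s x)] =
    \bigcup_(r in [set` fpowerset s] `&` Y) [set x | trace n s x = r].
  apply/seteqP; split => x /=; last by move=> [r [_ Yr] /= ->].
  move=> Yx; exists (trace n s x) => //; split => //=.
  by rewrite fpowersetE; apply/fsubsetP => b; rewrite !inE => /andP[].
apply: fin_bigcup_measurable; first by apply: finite_setIl; exact: finite_fset.
move=> r [/=]; rewrite fpowersetE => /fsubsetP rs _.
have -> : [set x | trace n s x = r] =
    \bigcap_(b in [set` s]) [set x | `[< active n b x >] = (b \in r)].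
  apply/seteqP; split => x /=.
    by move=> <- b /= bs; rewrite !inE bs.
  move=> h; apply/fsetP => b; rewrite !inE.
  have [bs|bs] /= := boolP (b \in s); first exact: h.
  by apply/esym/negbTE; apply: contra bs => /rs.
apply: fin_bigcap_measurable => // b _.
case: (b \in r).
  rewrite (_ : [set x | _] = active n b); first exact: active_measurable.
  by apply/seteqP; split => x /asboolP.
rewrite (_ : [set x | _] = ~` active n b).
  by apply: measurableC; exact: active_measurable.
by apply/seteqP; split => x /=; [move/negbT/asboolPn|move/asboolPn/negbTE].
Qed.

Lemma measurable_sample n s h : measurable_fun setT (fun x => h (sample n s x)).
Proof.
move=> _ Y _; rewrite setTI.
exact: (measurable_trace n s [set r | Y (h (finite_point r))]).
Qed.

Lemma incoherent_trace_negligible n s :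
  P.-negligible [set x | (\meet_(b <- trace n s x) b)%O = \bot%O].
Proof.
have : P.-negligible (\big[setU/set0]_(r <- fpowerset s |
    (\meet_(b <- r) b)%O == \bot%O)
    [set x | forall b, b \in r -> \val (repr b) x]).
  elim/big_ind : _ => [||r /eqP r0].
  - exact: negligible_set0.
  - by move=> ? ?; exact: negligibleU.
  have [X XE Xm] := @ma_class_meet _ _ _ P _ r repr.
  rewrite -XE; apply/negligibleP; first exact: msets_measurable.
  apply: ma_class_eq0; rewrite -Xm -[RHS]r0.
  by apply: eq_bigr => b _; rewrite /ma_class reprK.
apply: negligibleS => x /= m0; rewrite -bigcup_seq_cond.
exists (trace n s x) => /=.
  apply/andP; split; last exact/eqP.
  by rewrite fpowersetE; apply/fsubsetP => b; rewrite !inE => /andP[].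
move=> b; rewrite !inE => /andP[_ /asboolP].
by rewrite /active; case: ifP.
Qed.

(** For [s] large enough, the set on which [sample n s] contains [a] represents
    [a n]: this holds for the generators in [s], up to the null set where the
    trace is not centered, and passes to Boolean combinations since [sample] takes
    its values in ultrafilters. *)
Lemma sample_measure n a : A a -> exists s0, forall s, (s0 `<=` s)%fset ->
  P [set x | sval (sample n s x) a] = ma_measure (a n).
Proof.
move=> Aa; have sA := algA_subalgebra N; have [A0 A1 AC AI AU] := sA.
have mD s c : measurable [set x | sval (sample n s x) c].
  exact: (measurable_trace n s [set r | sval (finite_point r) c]).
pose D s c := mk_mset (mD s c).
pose Q := [set c | A c /\ exists s0, forall s, (s0 `<=` s)%fset ->
  ma_class P (D s c) = c n].
suff [_ [s0 s0P]] : Q a.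
  by exists s0 => s /s0P <-; rewrite ma_measure_pi.
apply: (generated_subalgebra_ind _ _ Aa); last first.
  move=> _ [b b0 <-]; split; first exact: algA_gen.
  exists [fset b]%fset => s; rewrite fsub1set => bs.
  have -> : gen N b n = ma_class P (mk_mset (active_measurable n b)).
    rewrite /gen; have [Nbn|nNbn] := pselect (N b n).
      rewrite mem_set// -[LHS]reprK; congr (ma_class P _).
      by apply: val_inj; rewrite /= /active asboolT.
    rewrite memNset//; congr (ma_class P _).
    by apply: val_inj; rewrite /= /active asboolF// => -[].
  apply: ma_class_eq; apply: negligibleS (incoherent_trace_negligible n s) => x /=.
  apply: contraPP => /eqP m0.
  have := finite_pointP (trace_neq0 n s x) m0 b0; rewrite !inE bs /= asboolE.
  by rewrite /sample => -[h1 h2] [[+ +]|[+ +]]; tauto.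
split.
- split => //; exists fset0 => s _; congr (ma_class P _); apply: val_inj => /=.
  by apply/seteqP; split => // x /= /stone0.
- split => //; exists fset0 => s _; congr (ma_class P _); apply: val_inj => /=.
  by apply/seteqP; split => // x /= _; exact: stone1.
- move=> c [Ac [s cs]]; split; first exact: AC.
  exists s => t st; rewrite (_ : D t _ = msetC (D t c)).
    by rewrite [LHS](esym (pi_compl _ _)) [X in ma_compl X]cs.
  by apply: val_inj; apply/seteqP; split => x /(stoneC sA _ Ac).
- move=> c e [Ac [s cs]] [Ae [t et]]; split; first exact: AI.
  exists (s `|` t)%fset => u; rewrite fsubUset => /andP[su tu].
  rewrite (_ : D u _ = msetI (D u c) (D u e)).
    by rewrite [LHS](esym (pi_meet _ _ _)) [X in ma_meet X]cs// [X in ma_meet _ X]et.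
  by apply: val_inj; apply/seteqP; split => x /(stoneI _ Ac Ae).
- move=> c e [Ac [s cs]] [Ae [t et]]; split; first exact: AU.
  exists (s `|` t)%fset => u; rewrite fsubUset => /andP[su tu].
  rewrite (_ : D u _ = msetU (D u c) (D u e)).
    by rewrite [LHS](esym (pi_join _ _ _)) [X in ma_join X]cs// [X in ma_join _ X]et.
  by apply: val_inj; apply/seteqP; split => x /(stoneU sA _ Ac Ae).
Qed.

(** The integrals along [sample n s] are bounded by the supremum norm, so they
    converge along an ultrafilter refining the directed order of the finite sets
    [s]; linearity and positivity pass to the limit, and the value at an indicator
    is eventually constant. *)
Lemma represents_ex : exists2 L : nat -> cfun K R -> R, represents L &
  forall n h, `|L n h| <= sup_norm h.
Proof.
pose V0 : set_system {fset B} := filter_from setT (fun s => [set t | (s `<=` t)%fset]).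
have V0F : ProperFilter V0.
  apply: filter_from_proper; last by move=> s _; exists s => /=.
  apply: filter_fromT_filter; first by exists fset0.
  by move=> s t; exists (s `|` t)%fset => u /=; rewrite fsubUset => /andP[].
have [V [VU V0V]] := ultraFilterLemma V0F.
pose I n h s := \int[P]_x h (sample n s x).
have Ib n h s : `|I n h s| <= sup_norm h.
  exact: (pushforward_le P (measurable_sample n s)).
have Icvg n h : cvg (I n h @ V) by exact: ultra_bounded_cvg (Ib n h).
exists (fun n h => lim (I n h @ V)); last first.
  move=> n h; rewrite ler_norml; apply/andP; split.
    apply: limr_ge => //; apply: filterE => s.
    by have := Ib n h s; rewrite ler_norml => /andP[].
  apply: limr_le => //; apply: filterE => s.
  by have := Ib n h s; rewrite ler_norml => /andP[].
move=> n; split.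
- move=> c f g.
  have -> : I n (c *: f + g) = (fun s => c * I n f s + I n g s).
    by apply/funext => s; exact: (pushforward_linear P (measurable_sample n s)).
  apply: cvg_lim => //; apply: cvgD; last exact: Icvg.
  by apply: cvgMr; exact: Icvg.
- move=> f f0; apply: limr_ge => //; apply: filterE => s.
  by apply: Rintegral_ge0 => x _; exact: f0.
- move=> a Aa; have [s0 s0P] := sample_measure n Aa.
  apply: lim_near_cst => //; apply: V0V; exists s0 => // s /= s0s.
  by rewrite /I (pushforward_hat_indic P (measurable_sample n s)) s0P.
Qed.

End Existence.

(** * The part of a functional living on an element of the measure algebra *)

Section FunctionalsOnTheMeasureAlgebra.
Context (d : measure_display) (T : measurableType d) (R : realType).
Variables (P : probability T R) (N : measAlg P -> set nat).
Notation B := (measAlg P).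
Notation K := (stoneK N).
Notation A := (algA N).
Implicit Types (b m x y : B) (F : K) (a : nat -> B) (f g h : cfun K R)
  (phi : cdual K R).

Lemma ma_prob_join_le x y : ma_prob (x `|` y)%O <= ma_prob x + ma_prob y.
Proof.
rewrite -lee_fin EFinD !ma_probE -[x]reprK -[y]reprK.
rewrite [(_ `|` _)%O](pi_join P) !ma_measure_pi /=.
by apply: measureU2; exact: msets_measurable.
Qed.

(** The constant sequence [m] need not belong to the algebra; this open set of
    points stands for the clopen set that it would define. *)
Definition below m : set K := [set F | exists2 a, sval F a & forall n, (a n <= m)%O].

Lemma below_disjoint m1 m2 F : (m1 `&` m2)%O = \bot%O -> below m1 F -> ~ below m2 F.
Proof.
move=> m12 [a1 Fa1 a1m] [a2 Fa2 a2m]; apply: (@stone0 _ _ _ F).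
suff <- : (a1 `&` a2)%O = \bot%O by apply/stoneI => //; exact: (@stone_sub _ _ _ F).
apply/funext => n; apply/eqP; rewrite -lex0 -m12; exact: leI2.
Qed.

Definition admissible m h :=
  (forall F, `|h F| <= 1) /\ (forall F, ~ below m F -> h F = 0).

Definition local_norm phi m : R := sup [set phi h | h in admissible m].

Lemma admissible0 m : admissible m 0.
Proof. by split => F; rewrite ?cfun0 ?normr0. Qed.

Section Ball.
Variable phi : cdual K R.
Hypothesis phi1 : dual_ball K R phi.

Lemma dual_ball_le1 h : (forall F, `|h F| <= 1) -> phi h <= 1.
Proof.
move=> h1; apply: le_trans (ler_norm _) _.
exact: dual_ball_le (stoneK_nonempty N) (@stoneK_compact _ _ _ _ N) _ _ phi1 h1.
Qed.

Lemma local_norm_has_ubound m : has_ubound [set phi h | h in admissible m].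
Proof. by exists 1 => _ [h [h1 _] <-]; exact: dual_ball_le1. Qed.

Lemma le_local_norm m h : admissible m h -> phi h <= local_norm phi m.
Proof. by move=> hm; apply: ub_le_sup; [exact: local_norm_has_ubound|exists h]. Qed.

Lemma local_norm_ge0 m : 0 <= local_norm phi m.
Proof. by rewrite -[leLHS](linear0 phi); apply: le_local_norm; exact: admissible0. Qed.

Lemma local_norm_le m (c : R) : (forall h, admissible m h -> phi h <= c) ->
  local_norm phi m <= c.
Proof.
move=> hc; apply: ge_sup; first by exists (phi 0); exists 0 => //; exact: admissible0.
by move=> _ [h hm <-]; exact: hc.
Qed.

Lemma local_norm_le1 m : local_norm phi m <= 1.
Proof. by apply: local_norm_le => h [h1 _]; exact: dual_ball_le1. Qed.

(** Functions with disjoint supports and values in [[-1, 1]] can be added without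
    leaving the unit ball. *)
Lemma local_norm_superadditive m1 m2 : (m1 `&` m2)%O = \bot%O ->
  local_norm phi m1 + local_norm phi m2 <= local_norm phi (m1 `|` m2)%O.
Proof.
move=> m12; rewrite -lerBrDr; apply: local_norm_le => f [f1 f0].
rewrite lerBrDr addrC -lerBrDr; apply: local_norm_le => g [g1 g0].
rewrite lerBrDr -cdualD; apply: le_local_norm; split => F.
  rewrite cfunD; have [Fm1|nFm1] := pselect (below m1 F).
    by rewrite g0 ?add0r//; exact: below_disjoint Fm1.
  by rewrite (f0 F)// addr0.
move=> nF; rewrite cfunD f0 ?g0 ?addr0//.
  by move=> [a Fa am]; apply: nF; exists a => // n; exact: le_trans (am n) (leUr _ _).
by move=> [a Fa am]; apply: nF; exists a => // n; exact: le_trans (am n) (leUl _ _).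
Qed.

(** Take [z] maximizing [local_norm phi z - C * ma_prob z] up to [1/2]. If the
    conclusion failed for some [m] disjoint from [z], joining [m] to [z] would
    increase this quantity by more than [1/2]. *)
Lemma local_norm_absolutely_continuous (C : R) : 0 < C ->
  exists2 z, C * ma_prob z <= 2 & forall m, (m `&` z)%O = \bot%O ->
  local_norm phi m <= C * ma_prob m + 2^-1.
Proof.
move=> C0; pose S := [set local_norm phi z - C * ma_prob z | z in [set: B]].
have S1 : has_sup S.
  split; first by exists (local_norm phi \bot%O - C * ma_prob (\bot%O : B)); exists \bot%O.
  exists 1 => _ [z _ <-]; rewrite lerBlDr; apply: le_trans (local_norm_le1 z) _.
  by rewrite lerDl mulr_ge0 ?ma_prob_ge0// ltW.
have [_ [z _ <-] zS] := @sup_adherent _ S 2^-1 ltac:(lra) S1.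
have le_S y : local_norm phi y - C * ma_prob y <= sup S.
  by apply: ub_le_sup; [case: S1|exists y].
exists z.
  have := le_S (\bot%O : B); rewrite ma_prob0 mulr0 subr0.
  move: zS (local_norm_ge0 \bot%O) (local_norm_le1 z).
  move: (C * _) (sup S) (local_norm phi z) (local_norm phi _) => p q u v; lra.
move=> m mz; move: zS (le_S (m `|` z)%O) (local_norm_superadditive mz).
have : C * ma_prob (m `|` z)%O <= C * ma_prob m + C * ma_prob z.
  by rewrite -mulrDr ler_pM2l//; exact: ma_prob_join_le.
move: (C * ma_prob (m `|` z)%O) (C * ma_prob m) (C * ma_prob z) (sup S).
move: (local_norm phi m) (local_norm phi z) (local_norm phi (m `|` z)%O).
by move=> *; lra.
Qed.

(** Let [h] be the sum of the [n] indicators, so that [phi h > 15n/16]. Its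
    truncation at [3n/4] contributes at most [3n/4]. The excess takes values in
    [[0, n/4]], and where it is positive more than [3n/4] of the generators meet,
    so it lives below [m]: thus [15n/16 < 3n/4 + n/4 * local_norm phi m]. *)
Lemma large_overlap_local_norm (I : choiceType) (J : {fset I}) (b : I -> B) m :
  (0 < #|` J|)%N ->
  (forall i, i \in J -> b i != \bot%O) ->
  (forall i, i \in J -> 15 / 16 < phi (hat_indic N (gen N (b i)))) ->
  (forall H : {fset I}, (H `<=` J)%fset -> (3 * #|` J| < 4 * #|` H|)%N ->
    (\meet_(i <- H) b i <= m)%O) ->
  3 / 4 <= local_norm phi m.
Proof.
move=> J0 b0 phib bm; set n : R := #|` J|%:R.
have n0 : 0 < n by rewrite ltr0n.
pose h : cfun K R := \sum_(i <- J) hat_indic N (gen N (b i)).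
pose H F := [fset i in J | `[< sval F (gen N (b i)) >]]%fset.
have HJ F : (H F `<=` J)%fset by apply/fsubsetP => i; rewrite !inE => /andP[].
have hE F : h F = #|` H F|%:R.
  rewrite cfun_sum; under eq_bigr do rewrite hat_indicE.
  rewrite -natr_sum; congr (_%:R); rewrite /H card_fset_sum1 -big_fset_condE.
  by rewrite [RHS]big_mkcond; apply: eq_bigr => i _; case: asbool.
have hn F : 0 <= h F <= n.
  by rewrite hE ler0n /= ler_nat; exact: fsubset_leq_card.
pose th := 3 / 4 * n.
have ch1 : continuous (fun F => Num.min (h F) th).
  move=> F; apply: continuous_min; first exact: cfun_continuous.
  exact: cst_continuous.
pose h1 : cfun K R := mk_cfun ch1.
have h1E F : h1 F = Num.min (h F) th by [].
pose h2 := h - h1.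
have hin : n * (15 / 16) < phi h.
  rewrite linear_sum /n card_fset_sum1 natr_sum mulr_suml.
  have [i0 i0J] : exists i0, i0 \in J by apply/fset0Pn; rewrite -cardfs_gt0.
  rewrite [ltLHS](big_rem i0)//= [ltRHS](big_rem i0)//=; apply: ltr_leD.
    by rewrite mul1r phib.
  rewrite big_seq [leRHS]big_seq; apply: ler_sum => i /mem_rem iJ.
  by rewrite mul1r ltW// phib.
have h1le : phi h1 <= th.
  have th0 : 0 < th by rewrite /th; lra.
  rewrite -[leRHS]mulr1 -ler_pdivrMl// -cdualZ; apply: dual_ball_le1 => F.
  rewrite cfunZ normrM gtr0_norm ?invr_gt0// ler_pdivrMl// mulr1 h1E.
  by have /andP[h0 _] := hn F; rewrite ger0_norm ?le_min ?h0 ?ge_min ?lexx ?orbT// ltW.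
have h2le : phi h2 <= n / 4 * local_norm phi m.
  have n4 : 0 < n / 4 by lra.
  rewrite -ler_pdivrMl// -cdualZ; apply: le_local_norm; split => F.
    rewrite cfunZ normrM gtr0_norm ?invr_gt0// ler_pdivrMl// mulr1 cfunB h1E.
    have /andP[h0 hle] := hn F; rewrite /th /Num.min; case: ifPn.
      by rewrite subrr normr0; lra.
    by rewrite -leNgt => hth; rewrite ger0_norm; lra.
  move=> nFm; rewrite cfunZ cfunB h1E min_l ?subrr ?mulr0//.
  rewrite leNgt; apply/negP => thh; apply: nFm.
  have r0 : \bot%O \notin [seq b i | i <- H F].
    apply/mapP => -[i iH bi]; have := b0 i; rewrite -bi eqxx => /(_ _)/negP; apply => //.
    exact: (fsubsetP (HJ F)).
  exists (\meet_(c <- [seq b i | i <- H F]) gen N c)%O.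
    apply/(mem_meet_gen F r0) => _ /mapP[i iH ->].
    by move: iH; rewrite !inE => /andP[_ /asboolP].
  move=> k; apply: le_trans (meet_gen_le _ _ _) _; rewrite big_map.
  apply: bm => //; move: thh; rewrite hE /th.
  by rewrite -(ltr_nat R) !natrM; lra.
have hphi : phi h = phi h1 + phi h2 by rewrite -cdualD addrC subrK.
rewrite -(@ler_pM2l _ (n / 4)); last by lra.
move: hin h1le h2le; rewrite hphi /th; lra.
Qed.

End Ball.

End FunctionalsOnTheMeasureAlgebra.

(** * Deviations of coin tossing *)

Section RademacherSums.
Context (J : finType) (R : realFieldType).
Implicit Types e : {ffun J -> bool}.

Let sg (b : bool) : R := if b then 1 else -1.

Lemma rademacher_second_moment :
  \sum_(e : {ffun J -> bool}) (\sum_i sg (e i)) ^+ 2 = #|J|%:R * 2 ^+ #|J|.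
Proof.
(* flipping the coordinate [i] changes the sign of the summand *)
have orth i j : i != j -> \sum_(e : {ffun J -> bool}) sg (e i) * sg (e j) = 0.
  move=> ij; pose flip e : {ffun J -> bool} := [ffun k => e k (+) (k == i)].
  have flipK : involutive flip.
    by move=> e; apply/ffunP => k; rewrite !ffunE -addbA addbb addbF.
  have E : \sum_(e : {ffun J -> bool}) sg (e i) * sg (e j) =
      - \sum_(e : {ffun J -> bool}) sg (e i) * sg (e j).
    rewrite [LHS](reindex_inj (inv_inj flipK)) -sumrN; apply: eq_bigr => e _.
    rewrite !ffunE eqxx (negbTE (_ : j != i)) 1?eq_sym// addbF -mulNr.
    by congr (_ * _); case: (e i); rewrite /sg //= opprK.
  lra.
under eq_bigr do rewrite expr2 mulr_suml.
rewrite exchange_big /=.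
under eq_bigr do under eq_bigr do rewrite mulr_sumr.
transitivity (\sum_(i : J) (2 : R) ^+ #|J|); last by rewrite sumr_const mulr_natl.
apply: eq_bigr => i _; rewrite exchange_big (bigD1 i)//= [X in _ + X]big1 ?addr0.
  rewrite (eq_bigr (fun=> 1)) => [|e _].
    by rewrite sumr_const card_ffun card_bool natrX.
  by rewrite /sg; case: ifP; rewrite ?mulr1// mulrNN mulr1.
by move=> j ji; apply: orth; rewrite eq_sym.
Qed.

(** Chebyshev's inequality: more than [3n/4] ones means a sum of signs larger than
    [n/2], whose square is at least [n^2/4]. *)
Lemma rademacher_large_deviation : (0 < #|J|)%N ->
  #|[pred e : {ffun J -> bool} | (3 * #|J| < 4 * #|[pred i | e i]|)%N]|%:R
    * (2^-1 : R) ^+ #|J| <= 4 / #|J|%:R.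
Proof.
move=> J0; set n : R := #|J|%:R; have n0 : 0 < n by rewrite ltr0n.
set D := [pred e | _].
have sumE e : \sum_i sg (e i) = 2 * #|[pred i | e i]|%:R - n.
  rewrite /n -!sum1_card !natr_sum mulr_sumr [in X in X - _]big_mkcond -sumrB.
  by apply: eq_bigr => i _; rewrite !inE /sg; case: (e i); lra.
have : #|D|%:R * (n ^+ 2 / 4) <= n * 2 ^+ #|J|.
  rewrite -rademacher_second_moment -sum1_card natr_sum mulr_suml big_mkcond /=.
  apply: ler_sum => e _; case: ifP => [|_]; last exact: sqr_ge0.
  rewrite inE -(ltr_nat R) !natrM -/n sumE mul1r => h.
  set c : R := #|_|%:R in h *.
  have -> : n ^+ 2 / 4 = (n / 2) ^+ 2 by rewrite expr_div_n; congr (_ / _); ring.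
  by rewrite ler_sqr ?nnegrE; lra.
move=> h; have p2 : 0 < (2 : R) ^+ #|J| by rewrite exprn_gt0.
have n24 : 0 < n ^+ 2 / 4 by rewrite divr_gt0// exprn_gt0.
rewrite exprVn ler_pdivrMr// -(ler_pM2r n24); apply: le_trans h _.
rewrite le_eqVlt; apply/orP; left; apply/eqP; field.
by rewrite gt_eqF.
Qed.

End RademacherSums.

Section Cube.
Context (R : realType) (kappa : choiceType).
Variable lambda : probability (baire R (cube kappa)) R.
Hypothesis lambda_product : coin_tossing lambda.
Notation T := (baire R (cube kappa)).
Implicit Types (al : kappa) (J : {fset kappa}).

Definition ones al : set T := [set x : kappa -> bool | x al].

Lemma ones_measurable al : measurable (ones al).
Proof.
apply: sub_sigma_algebra.
pose f (x : cube kappa) : R := if x al then 0 else 1.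
exists f.
  move=> x; apply: (@continuous_comp _ _ _ (fun y : cube kappa => y al)
    (fun b : bool => if b then 0 else 1 : R)).
    exact: (@proj_continuous kappa (fun=> bool) al x).
  move=> U /nbhs_singleton Ux.
  suff : nbhs (x al) [set b : bool | U (if b then 0 else 1 : R)] by [].
  by rewrite nbhs_principalE; apply/principal_filterP.
apply/seteqP; split => x; rewrite /f /=.
  by rewrite /ones /=; case: (x al) => // /eqP; rewrite oner_eq0.
by rewrite /ones /= => ->.
Qed.

Definition cylinder J (e : {ffun J -> bool}) : set T :=
  [set x : kappa -> bool | forall i : J, x (\val i) = e i].

Lemma cylinder_measurable J (e : {ffun J -> bool}) : measurable (cylinder e).
Proof.
rewrite (_ : cylinder e = \bigcap_(i in [set: J])
    (if e i then ones (\val i) else ~` ones (\val i))).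
  apply: fin_bigcap_measurable => // i _; case: ifP => _.
    exact: ones_measurable.
  by apply: measurableC; exact: ones_measurable.
apply/seteqP; split => x xe i.
  by move=> _; have := xe i; rewrite /ones /=; case: ifP => _ /= ->.
by have := xe i Logic.I; rewrite /ones /=; case: ifP => _ //= /negP/negbTE.
Qed.

Lemma cylinder_measure J (e : {ffun J -> bool}) :
  lambda (cylinder e) = (2^-1 ^+ #|` J|)%:E.
Proof.
pose e' al := if insub al is Some i then e i else false.
rewrite -(lambda_product J e'); congr (lambda _); apply/seteqP; split => x /= xe.
  by move=> al alJ; rewrite /e' insubT; have := xe [` alJ]%fset.
by move=> i; rewrite (xe _ (valP i)) /e' valK.
Qed.

Definition majority J : set T := [set x : kappa -> bool |
  (3 * #|` J| < 4 * #|` [fset al in J | x al]%fset|)%N].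

Lemma majority_cylinders J : majority J =
  \big[setU/set0]_(e : {ffun J -> bool} | (3 * #|{: J}| < 4 * #|[pred i | e i]|)%N)
    cylinder e.
Proof.
have cE (x : kappa -> bool) (e : {ffun J -> bool}) : (forall i : J, x (\val i) = e i) ->
    #|` [fset al in J | x al]%fset| = #|[pred i | e i]|.
  move=> xe; rewrite card_fset_sum1 -big_fset_condE big_seq_fsetE /= -sum1_card.
  by apply: eq_bigl => i; rewrite inE xe.
rewrite -bigcup_seq_cond; apply/seteqP; split => x.
  rewrite /majority /= => xJ; exists [ffun i => x (\val i)]; last first.
    by move=> i; rewrite ffunE.
  rewrite /= mem_index_enum /= -(cE x); last by move=> i; rewrite ffunE.
  by rewrite -cardfE.
move=> [e /= /andP[_ eJ] xe]; rewrite /majority /= (cE x e xe).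
by rewrite cardfE.
Qed.

Lemma majority_measurable J : measurable (majority J).
Proof.
rewrite majority_cylinders; apply: bigsetU_measurable => e _.
exact: cylinder_measurable.
Qed.

Lemma majority_measure J : (0 < #|` J|)%N ->
  (lambda (majority J) <= (4 / #|` J|%:R)%:E)%E.
Proof.
rewrite cardfE => J0.
apply: le_trans (_ : _ <= (#|[pred e : {ffun J -> bool} |
   (3 * #|{: J}| < 4 * #|[pred i | e i]|)%N]|%:R * 2^-1 ^+ #|{: J}|)%:E)%E _; last first.
  by rewrite lee_fin; exact: rademacher_large_deviation.
rewrite majority_cylinders mulr_natl -sumr_const.
have mU : forall r : seq {ffun J -> bool}, measurable (\big[setU/set0]_(e <- r |
    (3 * #|{: J}| < 4 * #|[pred i | e i]|)%N) cylinder e).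
  by move=> r; apply: bigsetU_measurable => e _; exact: cylinder_measurable.
elim: (index_enum _) => [|e r IH]; first by rewrite !big_nil measure0.
have := mU r; rewrite !big_cons /= inE; case: ifP => // _ mr.
apply: le_trans (measureU2 _ _ _) _ => //; first exact: cylinder_measurable.
rewrite EFinD; apply: leeD => //.
by have := cylinder_measure e; rewrite cardfE => <-.
Qed.

Lemma ones_inter_measure al be : al != be ->
  lambda (~` ones al `&` ~` ones be) = 4^-1%:E.
Proof.
move=> ab; have := lambda_product [fset al; be]%fset (fun=> false).
rewrite cardfs2 ab => E.
transitivity ((2^-1 : R) ^+ 2)%:E; last by rewrite exprVn -natrX.
rewrite -E; congr (lambda _); apply/seteqP; split => x /=.
  move=> [xa xb] ga; rewrite !inE /ones /= => /orP[]/eqP ->.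
    by apply/negbTE/negP.
  by apply/negbTE/negP.
by move=> h; split; rewrite /ones /= h ?inE ?eqxx ?orbT.
Qed.

End Cube.

Lemma countable_enum_in (X : Type) (D S : set X) (x0 : X) : countable D ->
  D `<=` S -> S x0 -> exists f : nat -> X, D `<=` range f /\ forall n, S (f n).
Proof.
move=> /pfcard_geP[->|[g]] DS Sx0; first by exists (fun=> x0); split => // x [].
exists g; split => [x Dx|n]; last by apply/DS/funS.
by have [n _ <-] := @surj _ _ _ _ g x Dx; exists n.
Qed.

(** * The unit ball is not weak*-separable *)

Section Nonseparability.
Context (R : realType) (kappa : choiceType).
Variable lambda : probability (baire R (cube kappa)) R.
Hypothesis lambda_product : coin_tossing lambda.
Hypothesis kappa_uncountable : ~ countable [set: kappa].
Variable N : measAlg lambda -> set nat.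
Hypothesis N_indep : independent_family N.
Notation T := (baire R (cube kappa)).
Notation B := (measAlg lambda).
Notation K := (stoneK N).
Implicit Types (b : B) (phi : cdual K R).

Lemma hat_gen_nonempty b : b != \bot%O -> exists F : K, sval F (gen N b).
Proof.
move=> b0; have [||F Fb] := @is_point_ex _ _ _ _ _ N_indep [fset b]%fset.
- by rewrite in_fset1 eq_sym.
- by rewrite big_seq_fset1.
- by exists F; apply/(Fb b b0); rewrite in_fset1.
Qed.

Lemma point_evaluation (F : K) :
  exists2 phi, dual_ball K R phi & forall h : cfun K R, phi h = h F.
Proof.
have [||phi phiE] := @mk_cdual K R (fun h => h F) 1.
- by [].
- move=> h; rewrite mul1r; exact: (cfun_le_sup_norm (stoneK_compact (N := N))).
exists phi; last by move=> h; rewrite phiE.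
apply: dual_ballP; first exact: stoneK_nonempty.
by move=> h; rewrite phiE; exact: (cfun_le_sup_norm (stoneK_compact (N := N))).
Qed.

Lemma dense_in_ball_large (D : set (cdual K R)) b :
  dual_ball K R `<=` closure D -> b != \bot%O ->
  exists2 phi, D phi & 15 / 16 < phi (hat_indic N (gen N b)).
Proof.
move=> DB /hat_gen_nonempty[F Fb]; have [phi phi1 phiE] := point_evaluation F.
apply: (closure_cdual_gt (DB _ phi1)).
by rewrite phiE hat_indicE asboolT//= mulr1n; lra.
Qed.

(** The class of the trace on [E] of the set where the coordinate [al] is 1. *)
Definition slice (E : set T) (mE : measurable E) al : B :=
  ma_class lambda (mk_mset (measurableI _ _ mE (ones_measurable al))).

(** If [n] of the slices were large for [phi], the set [M] of the [x] in [E] with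
    a [3/4]-majority of ones among the [n] coordinates would satisfy
    [3/4 <= local_norm phi M <= C * (4 / n) + 1/2], that is [n <= 16 C]. *)
Lemma slices_finite (E : set T) (mE : measurable E) phi (z : B) (C : R) :
  dual_ball K R phi -> 0 < C -> E `<=` ~` \val (repr z) ->
  (forall m : B, (m `&` z)%O = \bot%O -> local_norm phi m <= C * ma_prob m + 2^-1) ->
  finite_set [set al | slice mE al != \bot%O /\
    15 / 16 < phi (hat_indic N (gen N (slice mE al)))].
Proof.
move=> phi1 C0 Ez phiC; apply: contrapT => /infinite_set_fset.
set bad := [set al | _].
move=> /(_ (Num.truncn (16 * C)).+1)[J Jbad Jn].
have J0 : (0 < #|` J|)%N by apply: leq_trans Jn.
pose M := mk_mset (measurableI _ _ mE (majority_measurable J)).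
have Mz : (ma_class lambda M `&` z)%O = \bot%O.
  rewrite -[z]reprK [LHS](pi_meet lambda); congr (ma_class lambda _).
  by apply: val_inj; apply/seteqP; split => x //= [[/Ez]].
have := large_overlap_local_norm phi1 (b := slice mE) (m := ma_class lambda M) J0.
move=> /(_ (fun al alJ => (Jbad al alJ).1) (fun al alJ => (Jbad al alJ).2)).
have : (forall H : {fset kappa}, (H `<=` J)%fset -> (3 * #|` J| < 4 * #|` H|)%N ->
    (\meet_(i <- H) slice mE i <= ma_class lambda M)%O).
  move=> H HJ HJn.
  have [X XE ->] := @ma_class_meet _ _ _ lambda _ H
    (fun al => mk_mset (measurableI _ _ mE (ones_measurable al))).
  apply/eqP; rewrite [LHS](pi_meet lambda); congr (ma_class lambda _).
  apply: val_inj; rewrite /= XE; apply/seteqP; split => x /=; first by case.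
  move=> xH; split => //; split.
    have [i iH] : exists i, i \in H.
      apply/fset0Pn; rewrite -cardfs_gt0; lia.
    by have [] := xH i iH.
  rewrite /majority /=; apply: leq_trans HJn _; rewrite leq_mul2l /=.
  apply: fsubset_leq_card; apply/fsubsetP => i iH; rewrite !inE (fsubsetP HJ)//=.
  by have [_] := xH i iH.
move=> /[swap] /[apply] V34.
have := phiC _ Mz => VC.
have : ma_prob (ma_class lambda M) <= 4 / #|` J|%:R.
  rewrite -lee_fin ma_probE [leLHS]ma_measure_pi.
  apply: le_trans (majority_measure lambda_product J0).
  apply: le_measure; rewrite ?inE; [|exact: majority_measurable|by move=> x []].
  by apply: measurableI => //; exact: majority_measurable.
have n0 : 0 < #|` J|%:R :> R by rewrite ltr0n.
rewrite ler_pdivlMr// => Mn.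
have : 16 * C < #|` J|%:R.
  apply: lt_le_trans (truncnS_gt _) _; by rewrite ler_nat.
move: V34 VC Mn n0; move: (local_norm _ _) (ma_prob _) (#|` J|%:R : R) => v p n.
move=> v34 vC pn n0 Cn.
have : 4^-1 <= C * p by lra.
nra.
Qed.

Lemma dual_ball_not_separable : ~ separable_set (dual_ball K R).
Proof.
move=> [D [cD DB BD]].
have [F0 _] := stoneK_nonempty N.
have [phi0 phi01 _] := point_evaluation F0.
have [f [Df f1]] : exists f : nat -> cdual K R, D `<=` range f /\
    forall n, dual_ball K R (f n).
  exact: countable_enum_in phi01.
(* [2 / C k = 1 / 2 ^ (k + 2)], so that the exceptional sets have total measure at
   most 1/2 *)
pose C (k : nat) : R := 4 * (2 ^ k.+1)%:R.
have C0 k : 0 < C k by rewrite mulr_gt0// ltr0n expn_gt0.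
have [z zP] : {z : nat -> B & forall k, C k * ma_prob (z k) <= 2 /\
    forall m, (m `&` z k)%O = \bot%O ->
    local_norm (f k) m <= C k * ma_prob m + 2^-1}.
  apply: (@choice _ _ (fun k y => C k * ma_prob y <= 2 /\
    forall m, (m `&` y)%O = \bot%O ->
    local_norm (f k) m <= C k * ma_prob m + 2^-1)) => k.
  by have [y] := local_norm_absolutely_continuous (f1 k) (C0 k); exists y.
pose Z := \bigcup_k \val (repr (z k)).
have mz k : measurable (\val (repr (z k))) by exact: msets_measurable.
have mZ : measurable Z by exact: bigcupT_measurable.
pose E := ~` Z.
have mE : measurable E by exact: measurableC.
have Z2 : (lambda Z <= (2^-1 : R)%:E)%E.
  apply: le_trans (generalized_Boole_inequality lambda mz mZ) _.
  apply: le_trans (_ : _ <= \sum_(k <oo) (2^-1 / (2 ^ k.+1)%:R)%:E)%E _; last first.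
    by apply: (@epsilon_trick0 _ _ xpredT).
  apply: lee_nneseries => // k _; have [Ck _] := zP k.
  rewrite -[leLHS]/(ma_measure (z k)) -ma_probE lee_fin.
  have p0 : 0 < (2 ^ k.+1)%:R :> R by rewrite ltr0n expn_gt0.
  rewrite ler_pdivlMr//; move: Ck; rewrite /C.
  by move: (ma_prob (z k)) ((2 ^ k.+1)%:R : R) => p q; lra.
have E2 : (2^-1%:E <= lambda E)%E.
  have Zfin : lambda Z \is a fin_num by exact: fin_num_measure.
  rewrite probability_setC//; move: Z2; rewrite -(fineK Zfin) -EFinB !lee_fin.
  by move: (fine _) => p; lra.
pose bad k := [set al | slice mE al != \bot%O /\
    15 / 16 < f k (hat_indic N (gen N (slice mE al)))].
have bad_fin k : finite_set (bad k).
  have [_ zk] := zP k; apply: (@slices_finite E mE (f k) (z k) (C k) (f1 k) (C0 k) _ zk).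
  by move=> x nZ zx; apply: nZ; exists k.
have slice0 al : ~ (\bigcup_k bad k) al -> slice mE al = \bot%O.
  move=> nbad; apply: contrapT => /eqP b0; apply: nbad.
  have [phi /Df[k _ <-] phib] := dense_in_ball_large BD b0.
  by exists k.
have cbad : countable (\bigcup_k bad k).
  by apply: bigcup_countable => // k _; exact: finite_set_countable.
have ex_out (S : set kappa) : countable S -> exists al, ~ S al.
  move=> cS; apply: contrapT => /forallNP nS; apply: kappa_uncountable.
  by apply: sub_countable cS; apply: subset_card_le => al _; apply: contrapT; exact: nS.
have [al nal] := ex_out _ cbad.
have [be nbe] : exists be, ~ (\bigcup_k bad k `|` [set al]) be.
  apply: ex_out; rewrite -bigcup2E; apply: bigcup_countable => // -[|[|k]] _ //=.
have ab : al != be by apply/eqP => ab; apply: nbe; right.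
have E0 ga : ~ (\bigcup_k bad k) ga -> lambda (E `&` @ones R kappa ga) = 0%E.
  by move=> /slice0/ma_class_eq0.
have : (lambda E <= 4^-1%:E)%E.
  rewrite -(ones_inter_measure lambda_product ab).
  have mo ga : measurable (@ones R kappa ga) by exact: ones_measurable.
  have mEo ga : measurable (E `&` @ones R kappa ga) by exact: measurableI.
  have mC : measurable (~` @ones R kappa al `&` ~` @ones R kappa be).
    by apply: measurableI; exact: measurableC.
  apply: (@le_trans _ _ (lambda ((E `&` @ones R kappa al `|` E `&` @ones R kappa be) `|`
      (~` @ones R kappa al `&` ~` @ones R kappa be)))).
    apply: le_measure; rewrite ?inE//.
      by apply: measurableU => //; exact: measurableU.
    move=> x Ex; have [xa|xa] := pselect (@ones R kappa al x); first by left; left.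
    have [xb|xb] := pselect (@ones R kappa be x); first by left; right.
    by right.
  apply: le_trans (measureU2 _ _ mC) _; first exact: measurableU.
  rewrite -[leRHS]add0e; apply: leeD => //.
  apply: le_trans (measureU2 _ _ _) _ => //.
  have al0 := E0 al nal; have be0 := E0 be (fun h => nbe (or_introl h)).
  by rewrite [X in (X + _)%E]al0 [X in (_ + X)%E]be0 adde0.
move=> /(le_trans E2); rewrite lee_fin; lra.
Qed.

End Nonseparability.

(** * The space [C(K)] *)

Theorem theorem2p1 (R : realType)
  (kappa : choiceType)
  (omega1_le_kappa : ~ countable [set: kappa])
  (kappa_le_c : ([set: kappa] #<= [set: R])%card)
  (lambda : probability (baire R (cube kappa)) R)
  (lambda_product : coin_tossing lambda)
  (N : measAlg lambda -> set nat)
  (N_indep : independent_family N) :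
  [/\ ~ separable_set (dual_ball (stoneK N) R),
      forall mu : nat -> probability (borel (stoneK N)) R,
        (forall n, radon (mu n)) ->
        (forall n a, algA N a -> mu n (hat a) = ma_measure (a n)) ->
        forall h : cfun (stoneK N) R, h != 0 ->
        exists n, \int[mu n]_x h x != 0 &
      separable_set [set: cdual (stoneK N) R]].
Proof.
split.
- exact: dual_ball_not_separable.
- move=> mu _ muE h h0; apply: contrapT => /forallNP mu0; move/eqP: h0; apply.
  apply: (represents_separates N_indep (integrals_represent muE)) => n.
  by apply/eqP/negPn/negP => /mu0.
- have [L LP Lb] := represents_ex N_indep.
  have LE n : exists phi : cdual (stoneK N) R,
      (phi : cfun (stoneK N) R -> R) = L n.
    by apply: (@mk_cdual _ _ _ 1) => [|h]; [have [] := LP n|rewrite mul1r].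
  have [phi phiE] := choice LE.
  apply: (@separating_separable _ _ phi) => h h0.
  by apply: (represents_separates N_indep LP) => n; rewrite -phiE h0.
Qed.
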